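(* Let $f$ be a rational function on $\mathbb{P}^1=\mathbb{C}\cup\{\infty\}$ of degree $d>1$, and let $F=(F_0,F_1)$ be a lift of $f$. Suppose that a Fatou component $D_\infty$ of $f$ contains $\infty$ and that $f(D_\infty)=D_\infty$. Then for every $z\in\mathbb{C}\setminus f^{-1}(\infty)$, $$p_{\mu_f}(f(z))=d\cdot p_{\mu_f}(z)-\log|F_0(1,z)|+(d-1)G^F(0,1).$$
   Context: The Fatou set $F(f)$ of $f$ is the region of normality of the iterates $\{f^k; k\in\mathbb{N}\}$ in $\mathbb{P}^1$ (an open set); a Fatou component is a connected component of $F(f)$; the Julia set is $J(f)=\mathbb{P}^1\setminus F(f)$. Let $\pi:\mathbb{C}^2\setminus\{0\}\to\mathbb{P}^1$ be the projection $\pi(z_0,z_1)=z_1/z_0$ if $z_0\ne0$, and $\pi(z_0,z_1)=\infty$ if $z_0=0$. A lift of $f$ is a homogeneous polynomial map $F=(F_0,F_1):\mathbb{C}^2\to\mathbb{C}^2$ of algebraic degree $d$ with $\pi\circ F=f\circ\pi$ on $\mathbb{C}^2\setminus\{0\}$ and $F^{-1}(0)=\{0\}$; thus $f(z)=F_1(1,z)/F_0(1,z)$. It is unique up to multiplication by a constant in $\mathbb{C}^*$. The dynamical Green function of $F$ is $G^F:=\lim_{k\to\infty}\frac{1}{d^k}\log\|F^k\|:\mathbb{C}^2\to\mathbb{R}\cup\{-\infty\}$, where $\|\cdot\|$ is the Euclidean norm and $F^k$ is the $k$-th iterate; the convergence is uniform on $\mathbb{C}^2\setminus\{0\}$, so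 $G^F$ is continuous there. The function $G^F(1,\cdot)$ is continuous on $\mathbb{C}$ and $\delta$-subharmonic on $\mathbb{P}^1$ (locally a difference of two subharmonic functions). The balanced measure $\mu_f$ is the unique probability measure on $\mathbb{P}^1$ satisfying $\mathrm{d}\mathrm{d}^c G^F(1,\cdot)=\mu_f-\delta_\infty$, where $\mathrm{d}\mathrm{d}^c=(i/\pi)\partial\overline{\partial}$ (so that $\mathrm{d}\mathrm{d}^c\log|\cdot-w|=\delta_w-\delta_\infty$ for $w\in\mathbb{C}$) and $\delta_w$ is the Dirac measure at $w$. It does not depend on the choice of the lift $F$, and $\operatorname{supp}\mu_f=J(f)$ (a compact subset of $\mathbb{C}$ when $\infty\in F(f)$). For a finite Borel measure $\nu$ on $\mathbb{C}$ with compact support, its logarithmic potential is $p_\nu(z)=\int_{\mathbb{C}}\log|z-w|\,\mathrm{d}\nu(w)$, $z\in\mathbb{C}$. *)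

(* Defs.v *)
From HB Require Import structures.
From mathcomp Require Import all_boot all_order all_algebra.
From mathcomp Require Import all_classical all_reals all_analysis.
From mathcomp Require Export complex.
Set Implicit Arguments.
Unset Strict Implicit.
Unset Printing Implicit Defensive.
Import Order.TTheory GRing.Theory Num.Theory.
Import numFieldNormedType.Exports.
Import Normc.
Local Open Scope classical_set_scope.
Local Open Scope ring_scope.
Local Open Scope complex_scope.

(* The Riemann sphere: [None] is the point at infinity. The topology of the
   complex plane is the one carried by the alias [R[i]^o] of [R[i]]. *)
Notation P1 R := (one_point_compactification (R[i]^o)).

Notation borelP1 R := (g_sigma_algebraType (@open (P1 R))).

Section Defs.
Context {R : realType}.

Definition proj (v : R[i] * R[i]) : P1 R :=
  if v.1 == 0 then None else Some (v.2 / v.1).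

(* The value at infinity is read off the coefficients of degree [d], [d] being
   the larger of the degrees of [P] and [Q]. *)
Definition rational_map (d : nat) (f : P1 R -> P1 R) : Prop :=
  exists P Q : {poly R[i]},
    [/\ coprimep P Q, maxn (size P) (size Q) = d.+1,
        forall z : R[i], f (Some z) = proj (Q.[z], P.[z])
      & f None = proj (Q`_d, P`_d)].

Definition chordal (x y : P1 R) : R :=
  match x, y with
  | Some z, Some w =>
      normc (z - w)
        / (Num.sqrt (1 + normc z ^+ 2) * Num.sqrt (1 + normc w ^+ 2))
  | Some z, None | None, Some z => (Num.sqrt (1 + normc z ^+ 2))^-1
  | None, None => 0
  end.

(* Normality of the family of all iterates of [f] on [U]. *)
Definition normal_on (f : P1 R -> P1 R) (U : set (P1 R)) : Prop :=
  forall n : nat -> nat, exists (j : nat -> nat) (g : P1 R -> P1 R),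
    {homo j : a b / (a < b)%N} /\
    forall K : set (P1 R), compact K -> K `<=` U ->
    forall e : R, 0 < e ->
    \forall k \near \oo, forall x, K x ->
      chordal (iter (n (j k)) f x) (g x) < e.

Definition fatou (f : P1 R -> P1 R) : set (P1 R) :=
  \bigcup_(U in [set U | open U /\ normal_on f U]) U.

Definition fatou_component (f : P1 R -> P1 R) (D : set (P1 R)) : Prop :=
  exists2 x, fatou f x & D = connected_component (fatou f) x.

Definition homogeneous (d : nat) (h : R[i] * R[i] -> R[i]) : Prop :=
  exists a : 'I_d.+1 -> R[i], forall v,
    h v = \sum_(i < d.+1) a i * v.1 ^+ (d - i) * v.2 ^+ i.

Definition is_lift (d : nat) (f : P1 R -> P1 R)
    (F : R[i] * R[i] -> R[i] * R[i]) : Prop :=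
  [/\ homogeneous d (fun v => (F v).1), homogeneous d (fun v => (F v).2),
      forall v, v != (0, 0) -> proj (F v) = f (proj v)
    & forall v, F v = (0, 0) <-> v = (0, 0)].

Definition enorm (v : R[i] * R[i]) : R :=
  Num.sqrt (normc v.1 ^+ 2 + normc v.2 ^+ 2).

(* [lne] is used rather than [ln] because [ln 0 = 0], while [lne 0 = -oo]. *)
Definition green (d : nat) (F : R[i] * R[i] -> R[i] * R[i])
    (v : R[i] * R[i]) : \bar R :=
  limn (fun k => (d%:R ^- k)%:E * lne (enorm (iter k F v))%:E)%E.

Definition toC (p : R * R) : R[i] := p.1 +i* p.2.

Fixpoint Ck (k : nat) (u : R * R -> R) : Prop :=
  match k with
  | 0 => continuous u
  | k'.+1 =>
      [/\ forall p, derivable u p (1, 0), forall p, derivable u p (0, 1),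
          Ck k' ('D_(1, 0) u) & Ck k' ('D_(0, 1) u)]
  end.

Definition smooth (u : R * R -> R) : Prop := forall k, Ck k u.

Definition laplacian (u : R * R -> R) (p : R * R) : R :=
  'D_(1, 0) ('D_(1, 0) u) p + 'D_(0, 1) ('D_(0, 1) u) p.

(* Smoothness on the sphere, in the charts [z] and [w = 1 / z]. *)
Definition smoothP1 (phi : P1 R -> R) : Prop :=
  smooth (fun p => phi (proj (1, toC p))) /\
  smooth (fun p => phi (proj (toC p, 1))).

(* The current [ddc u] on the sphere paired with a test function, i.e. the
   integral of [u ddc phi]. With [ddc = (i / pi) del delbar], the 2-form
   [ddc phi] is [(2 pi)^-1 laplacian phi dx dy] in the chart [z = x + i y],
   whose complement is a single point and carries no mass of this form. *)
Definition ddc (u : R[i] -> \bar R) (phi : P1 R -> R) : \bar R :=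
  (\int[(@lebesgue_measure R \x @lebesgue_measure R)%E]_p
     (u (toC p) *
      ((2 * pi)^-1 * laplacian (fun q => phi (Some (toC q))) p)%:E))%E.

(* [ddc G(1, .) = mu - delta_oo], for the Green function [G] of the lift [F]. *)
Definition balanced_measure (d : nat) (F : R[i] * R[i] -> R[i] * R[i])
    (mu : probability (borelP1 R) R) : Prop :=
  forall phi : P1 R -> R, smoothP1 phi ->
    ddc (fun z => green d F (1, z)) phi
    = (\int[mu]_x (phi x)%:E - (phi None)%:E)%E.

(* The integral runs over the complex plane inside the sphere: the value given
   to the integrand at infinity plays no role. *)
Definition log_potential (mu : probability (borelP1 R) R) (z : R[i]) : \bar R :=
  (\int[mu]_(x in range (@Some R[i]))
     (if x is Some w then lne (normc (z - w))%:E else 0))%E.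

End Defs.

(* Main.v *)
Require Import Defs.
From mathcomp Require Import all_boot all_order all_algebra.
From mathcomp Require Import all_classical all_reals all_analysis.
From mathcomp Require Import ring lra measurable_realfun.
Import Order.TTheory GRing.Theory Num.Theory.
Import numFieldNormedType.Exports.
Import Normc.
Local Open Scope classical_set_scope.
Local Open Scope ring_scope.

(** The obstacle is that [mu] is known only through its pairings with functions smooth on the whole
    sphere, whereas [log |w - z|] is singular both at [z] and at infinity. The parameter [e] rounds
    off the pole at [z]. The parameter [t] caps the growth at infinity: both logarithms grow like
    [log |w|], so their difference extends smoothly there, with value [- ln t].

    The constant [G (0, 1)] comes from averaging [G (1, .)] at the large scale [1 / t]. Since [G] is
    logarithmically homogeneous, this average is [- ln t] plus an average of [G] at the vectors
    [(t, t z + p)], which tend to [(0, p)]; there [G] equals [log |p| + G (0, 1)]. The divergent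
    [- ln t] is exactly the value of the test function at infinity, so the two cancel before any
    limit is taken. The inversion [r -> 1 / r] explains why [log |p|] averages to [0].

    Monotone convergence needs only signs, and the finite limits found on the side of [G] supply the
    integrability afterwards. For the averages of [G], the estimate [G v = log |v| + O(1)] gives a
    single integrable majorant. *)

(* Write [G] for the Green function of [F]. The potential is [p_mu z = G (1, z) - G (0, 1)] for
   every [z]; the identity then follows from [G (F v) = d G v] and [G (c v) = log |c| + G v].

   To compute the potential at [z], the equation [ddc G(1, .) = mu - delta_oo] is tested against
   the smooth functions on the sphere
     [1/2 log (|w - z|^2 + e^2) - 1/2 log (1 + t^2 |w - z|^2)],
   whose Laplacian is a difference of two rescaled copies of the density
   [K = 1 / (pi (1 + |w|^2)^2)]. Since the integral of [K] is [1] and that of [log |w| K w] is [0],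
   the left-hand side tends to [G (1, z) - G (0, 1)] as [e, t -> 0]. On the side of [mu], monotone
   convergence is applied first for [t -> 0], which shows in passing that [mu] has no mass at
   infinity, and then for [e -> 0]. *)

(** * Radial integrals in the plane *)

Lemma preimage_affine_ocitv (R : realType) (a s u v : R) : 0 < s ->
  (fun x => a + s * x) @^-1` `]u, v]%classic = `](u - a) / s, (v - a) / s]%classic.
Proof.
move=> s0; apply/seteqP; split => x /=; rewrite !in_itv/= ltr_pdivrMr// ler_pdivlMr//;
  rewrite (mulrC x); lra.
Qed.

Lemma measurable_affine (R : realType) (a s : R) :
  measurable_fun setT (fun x : measurableTypeR R => a + s * x : measurableTypeR R).
Proof. by apply: measurable_funD => //; exact: measurable_funM. Qed.

(** The pushforward of Lebesgue measure under [x -> a + s * x], scaled by [s], agrees with Lebesgue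
    measure on half-open intervals, hence on all Borel sets. Nothing beyond measurability of [f] is
    then required. *)
Lemma ge0_integral_affine (R : realType) (a s : R) (f : R -> \bar R) : 0 < s ->
  measurable_fun setT f -> (forall x, 0 <= f x)%E ->
  (\int[lebesgue_measure]_x f x = s%:E * \int[lebesgue_measure]_x f (a + s * x)%R)%E.
Proof.
move=> s0 mf f0.
pose m := measure_function_pushforward__canonical__measure_function_Measure
  (@lebesgue_measure R) (@measurable_affine R a s).
pose k := NngNum (ltW s0).
have E A : measurable A -> lebesgue_measure A = mscale k m A.
  apply: lebesgue_measure_unique => _ [[u v] _ <-] /=.
  rewrite /mscale /= /pushforward preimage_affine_ocitv// !lebesgue_measure_itv/= !lte_fin.
  rewrite ltr_pM2r ?invr_gt0// ltrBlDr subrK.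
  case: ifP => _; last by rewrite mule0.
  by rewrite -!EFinB -EFinM; congr (_%:E); field; rewrite gt_eqF.
rewrite (@eq_measure_integral _ _ _ setT (mscale k m))//; last by move=> A mA _; exact: E.
rewrite ge0_integral_mscale//= ge0_integral_pushforward//; exact: measurable_affine.
Qed.

Lemma ge0_integral2_affine (R : realType) (a b s : R) (f : R * R -> \bar R) : 0 < s ->
  measurable_fun setT f -> (forall x, 0 <= f x)%E ->
  (\int[(@lebesgue_measure R \x @lebesgue_measure R)%E]_p f p =
   (s ^+ 2)%:E * \int[(@lebesgue_measure R \x @lebesgue_measure R)%E]_p
     f (a + s * p.1, b + s * p.2)%R)%E.
Proof.
move=> s0 mf f0.
have mA : measurable_fun setT (fun p : R * R => (a + s * p.1, b + s * p.2)).
  by apply: measurable_fun_pair; apply: measurable_funD => //; apply: measurable_funM.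
have mfA : measurable_fun setT (fun p : R * R => f (a + s * p.1, b + s * p.2)).
  exact: measurableT_comp.
rewrite (@fubini_tonelli1 _ _ _ _ R lebesgue_measure lebesgue_measure f)//.
rewrite (@fubini_tonelli1 _ _ _ _ R lebesgue_measure lebesgue_measure
  (fun p => f (a + s * p.1, b + s * p.2)))//.
rewrite /fubini_F/=.
rewrite (@ge0_integral_affine _ a s)//; last 2 first.
  exact: measurable_fun_fubini_tonelli_F.
  by move=> x; exact: integral_ge0.
rewrite expr2 EFinM -muleA; congr (_ * _)%E.
rewrite -ge0_integralZl//; last 3 first.
  exact: (@measurable_fun_fubini_tonelli_F _ _ _ _ R lebesgue_measure
    (fun p => f (a + s * p.1, b + s * p.2))).
  by move=> x _; exact: integral_ge0.
  by rewrite lee_fin ltW.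
apply: eq_integral => x _; rewrite (@ge0_integral_affine _ b s)//.
exact: measurableT_comp (pair1_measurable _).
Qed.

Lemma ge0_integral_evenT (R : realType) (f : R -> \bar R) :
  measurable_fun setT f -> (forall x, 0 <= f x)%E -> (forall x, f (- x) = f x) ->
  (\int[lebesgue_measure]_x f x = 2%:E * \int[lebesgue_measure]_(x in `]0%R, +oo[) f x)%E.
Proof.
move=> mf f0 fN.
have mS (A : set R) : measurable_fun A f by exact: measurable_funTS.
have UT : [set: R] = `]-oo, 0] `|` `]0, +oo[ :> set R.
  by apply/seteqP; split=> x //= _; rewrite !in_itv/= andbT; case: (leP x 0) => ?; [left|right].
rewrite UT ge0_integral_setU//=; last 2 first.
  exact: mS.
  rewrite disj_set2E; apply/eqP/seteqP; split=> x //= -[]; rewrite !in_itv/= andbT => x0.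
  by rewrite ltNge x0.
rewrite [X in (X + _)%E](_ : _ = \int[lebesgue_measure]_(x in `]-oo, 0%R]) f (- x)%R)%E; last first.
  by apply: eq_integral => x _; rewrite fN.
rewrite -ge0_integration_by_substitution0//.
rewrite -integral_itv_obnd_cbnd//.
by rewrite [2]mulr2n EFinD ge0_muleDl// ?mul1e// lee_fin.
Qed.

(** Source of the angular factor in polar coordinates: [x] plays the cotangent of the angle over one
    half-plane, and the two half-planes together give [2 * pi]. *)
Lemma integral_oneDsqrV (R : realType) :
  (\int[lebesgue_measure]_x (1 + x ^+ 2)^-1%:E = pi%:E :> \bar R)%E.
Proof.
have h0 x : 0 <= (oneDsqr x)^-1 :> R by rewrite invr_ge0 addr_ge0// sqr_ge0.
rewrite (@ge0_symfun_integralT R (fun x => (oneDsqr x)^-1))//.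
- rewrite (_ : [set x | _] = `[0, +oo[%classic); last first.
    by apply/seteqP; split => x/=; rewrite in_itv/= andbT.
  by rewrite integral0y_oneDsqr -EFinM; congr (_%:E); field.
- exact: continuous_oneDsqrV.
- by move=> x/=; rewrite /oneDsqr sqrrN.
Qed.

Section radial.
Context {R : realType}.
Local Notation leb := (@lebesgue_measure R).
Local Notation leb2 := (leb \x leb)%E.

(* Polar coordinates by Tonelli: on the line at height [y] substitute [x = |y| t], exchange
   the integrals, then substitute [y = s / sqrt (1 + t^2)]. *)
Lemma ge0_integral_radial (h : R -> R) : measurable_fun setT h -> (forall r, 0 <= h r) ->
  (\int[leb2]_p (h (p.1 ^+ 2 + p.2 ^+ 2))%:E =
   (2 * pi)%:E * \int[leb]_(s in `]0%R, +oo[) (s * h (s ^+ 2))%:E)%E.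
Proof.
move=> mh h0.
have mf : measurable_fun setT (fun p : R * R => (h (p.1 ^+ 2 + p.2 ^+ 2))%:E).
  apply/measurable_EFinP; apply: measurableT_comp => //.
  by apply: measurable_funD; apply: measurable_funX.
rewrite (@fubini_tonelli2 _ _ _ _ R leb leb _ mf)//; last by move=> x; rewrite lee_fin.
pose k (p : R * R) := (`|p.2| * h (p.2 ^+ 2 * (1 + p.1 ^+ 2)))%:E.
have mk : measurable_fun setT k.
  apply/measurable_EFinP; apply: measurable_funM; first exact: measurableT_comp.
  apply: measurableT_comp => //; apply: measurable_funM; first exact: measurable_funX.
  by apply: measurable_funD => //; apply: measurable_funX.
have k0 p : (0 <= k p)%E by rewrite lee_fin mulr_ge0.
transitivity (\int[leb]_y \int[leb]_t k (t, y))%E.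
  apply: ge0_ae_eq_integral => //.
  - by apply: (@measurable_fun_fubini_tonelli_G _ _ _ _ R leb _ mf) => x; rewrite lee_fin.
  - exact: (@measurable_fun_fubini_tonelli_G _ _ _ _ R leb k mk).
  - by move=> y _; apply: integral_ge0 => x _; rewrite lee_fin.
  - by move=> y _; apply: integral_ge0.
  (* The substitution [x = |y| t] degenerates at height [0], so the inner integrals are compared off
     this null set. *)
  - exists [set 0]; split => //; first exact: lebesgue_measure_set1.
    move=> y /= ny; apply: contrapT => y0; apply: ny => _.
    have y1 : 0 < `|y| by rewrite normr_gt0; exact/eqP.
    rewrite /fubini_G/= (@ge0_integral_affine _ 0 `|y|)//; last 2 first.
      exact: (measurable_fun_pair1 y mf).
      by move=> x; rewrite lee_fin.
    rewrite -ge0_integralZl//; last 2 first.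
      apply/measurable_EFinP; apply: measurableT_comp => //.
      apply: measurable_funD => //; apply: measurable_funX.
      exact: measurable_affine.
      by move=> x _; rewrite lee_fin.
    apply: eq_integral => x _; rewrite -EFinM /k/=; congr (_ * h _)%:E.
    by rewrite add0r exprMn real_normK ?num_real//; ring.
rewrite -(@fubini_tonelli _ _ _ _ R leb leb k mk)//.
set J := (\int[leb]_(s in `]0%R, +oo[) (s * h (s ^+ 2))%:E)%E.
have J0 : (0 <= J)%E.
  by apply: integral_ge0 => x /=; rewrite in_itv/= andbT lee_fin => x0; rewrite mulr_ge0// ltW.
have JE : (\int[leb]_s (`|s| * h (s ^+ 2))%:E = 2%:E * J)%E.
  rewrite ge0_integral_evenT//.
  - congr (_ * _)%E; apply: eq_integral => x; rewrite inE/= in_itv/= andbT => x0.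
    by rewrite gtr0_norm.
  - apply/measurable_EFinP; apply: measurable_funM; first exact: normr_measurable.
    by apply: measurableT_comp => //; apply: measurable_funX.
  - by move=> x; rewrite lee_fin mulr_ge0.
  - by move=> x; rewrite normrN sqrrN.
transitivity (\int[leb]_t ((1 + t ^+ 2)^-1%:E * (2%:E * J)))%E.
  apply: eq_integral => t _; rewrite -JE.
  have t0 : 0 < 1 + t ^+ 2 by rewrite ltr_pwDl// sqr_ge0.
  pose c := (Num.sqrt (1 + t ^+ 2))^-1.
  have c0 : 0 < c by rewrite invr_gt0 sqrtr_gt0.
  have c2 : c ^+ 2 = (1 + t ^+ 2)^-1 by rewrite exprVn sqr_sqrtr// ltW.
  rewrite (@ge0_integral_affine _ 0 c (fun y => k (t, y)))//; last first.
    exact: (measurable_fun_pair2 t mk).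
  rewrite -c2 expr2 EFinM -muleA; congr (_ * _)%E.
  rewrite -ge0_integralZl//; last 3 first.
    apply/measurable_EFinP; apply: measurable_funM; first exact: normr_measurable.
    by apply: measurableT_comp => //; apply: measurable_funX.
    by move=> x _; rewrite lee_fin mulr_ge0.
    by rewrite lee_fin ltW.
  apply: eq_integral => x _; rewrite /k/= -EFinM; congr (_%:E).
  rewrite add0r normrM (gtr0_norm c0) -mulrA; congr (_ * (_ * h _)).
  by rewrite exprMn c2 mulrAC mulVf ?mul1r// gt_eqF.
rewrite ge0_integralZr//.
- by rewrite integral_oneDsqrV muleA -EFinM mulrC.
- apply/measurable_EFinP; apply: continuous_measurable_fun; exact: continuous_oneDsqrV.
- by move=> x _; rewrite lee_fin invr_ge0 addr_ge0// sqr_ge0.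
- by apply: mule_ge0.
Qed.
End radial.

(** * One-variable integrals behind the spherical density *)

Section kernel_integrals.
Context {R : realType}.
Local Notation leb := (@lebesgue_measure R).
Local Notation leb2 := (leb \x leb)%E.

(** At [0] only limits from the right are required, because the primitive used in [integral_kernel3]
    contains [s ^+ 2 * ln s]. *)
Lemma ge0_FTC0y (f F : R -> R) (l : R) :
  (forall x, 0 <= x -> 0 <= f x) -> f x @[x --> (0 : R)^'+] --> f 0 ->
  F x @[x --> (0 : R)^'+] --> F 0 ->
  (forall x : R, 0 < x -> {for x, continuous f}) -> (forall x : R, 0 < x -> is_derive x 1 F (f x)) ->
  F x @[x --> +oo] --> l ->
  (\int[leb]_(x in `]0%R, +oo[) (f x)%:E = (l - F 0)%:E)%E.
Proof.
move=> f0 cf0 cF0 cf dF Fl.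
have cfw : {within `[0, +oo[, continuous f}.
  apply/continuous_within_itvcyP; split => // x; rewrite in_itv/= andbT; exact: cf.
rewrite integral_itv_obnd_cbnd; last first.
  apply/measurable_EFinP; apply: open_continuous_measurable_fun => // x.
  by rewrite inE/= in_itv/= andbT; exact: cf.
rewrite (ge0_continuous_FTC2y f0 cfw Fl)//.
  by move=> x x0; have [] := dF _ x0.
by move=> x; rewrite in_itv/= andbT => /dF [_ <-]; rewrite derive1E.
Qed.

(** Apply [ln y < y] to [x] and to its inverse. This is the origin of the weight [r + r^-1] in all
    the majorants below. *)
Lemma abs_ln_le (x : R) : 0 < x -> `|ln x| <= x + x^-1.
Proof.
move=> x0; have y0 : 0 < x^-1 by rewrite invr_gt0.
have := ln_sublinear x0; have := ln_sublinear y0; rewrite lnV ?posrE// => h1 h2.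
by rewrite ler_norml; apply/andP; split; lra.
Qed.

(** The previous bound at the square root of [x]. The weaker pole makes [x * ln x] tend to [0] at
    [0], where [abs_ln_le] itself would only give boundedness. *)
Lemma abs_ln_le_sqrt (x : R) : 0 < x -> `|ln x| <= 2 * (Num.sqrt x + (Num.sqrt x)^-1).
Proof.
move=> x0; rewrite -[in leLHS](sqr_sqrtr (ltW x0)) lnXn ?sqrtr_gt0// normrMn -[leLHS]mulr_natl.
by rewrite ler_pM2l//; apply: abs_ln_le; rewrite sqrtr_gt0.
Qed.

Lemma onePsqr_gt0 (x : R) : 0 < 1 + x ^+ 2. Proof. by rewrite ltr_pwDl// sqr_ge0. Qed.
Lemma onePsqr_neq0 (x : R) : 1 + x ^+ 2 != 0. Proof. by rewrite gt_eqF ?onePsqr_gt0. Qed.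
Hint Resolve onePsqr_gt0 onePsqr_neq0 : core.

Lemma cvg_onePsqrV (x : R) : (1 + s ^+ 2)^-1 @[s --> x] --> ((1 + x ^+ 2)^-1 : R).
Proof. exact: continuous_oneDsqrV. Qed.

Lemma cvg_sqr (T : Type) (F : set_system T) (FF : Filter F) (f : T -> R) (a : R) :
  f x @[x --> F] --> a -> f x ^+ 2 @[x --> F] --> a ^+ 2.
Proof. by move=> fa; under eq_fun do rewrite expr2; rewrite expr2; exact: cvgM. Qed.

Lemma cvgy_inv : (x^-1 : R) @[x --> +oo] --> (0 : R).
Proof. by apply/gtr0_cvgV0; [near=> x; near: x; exact: nbhs_pinfty_gt|exact: cvg_id].
Unshelve. all: by end_near. Qed.

Lemma integral_kernel1 :
  (\int[leb]_(s in `]0%R, +oo[) (s / (1 + s ^+ 2) ^+ 2)%:E = (1 / 2)%:E)%E.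
Proof.
pose F (s : R) := - (1 / 2) * (1 + s ^+ 2)^-1.
have cont (x : R) : {for x, continuous (fun s : R => s / (1 + s ^+ 2) ^+ 2)}.
  apply: cvgM; first exact: cvg_id.
  under eq_fun do rewrite -exprVn.
  rewrite -exprVn; exact: cvg_sqr (cvg_onePsqrV x).
rewrite (_ : (1 / 2)%:E = (0 - F 0)%:E); last first.
  by rewrite /F expr0n/= addr0 invr1; congr (_%:E); field.
apply: ge0_FTC0y => //.
- by move=> x x0; rewrite divr_ge0// sqr_ge0.
- exact: cvg_at_right_filter (cont 0).
- apply: cvg_at_right_filter; apply: cvgMl_tmp; exact: cvg_onePsqrV.
- move=> x x0; have nz := onePsqr_neq0 x.
  by apply: is_derive_eq; rewrite /GRing.scale/=; field.
- rewrite -(mulr0 (- (1 / 2))); apply: cvgMl_tmp.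
  apply: (@squeeze_cvgr _ _ _ _ (cst 0) (fun x => x^-1)); last 2 first.
  + exact: cvg_cst.
  + exact: cvgy_inv.
  near=> x; have x1 : 1 <= x by near: x; exact: nbhs_pinfty_ge.
  have x0 : 0 < x by rewrite (lt_le_trans ltr01).
  rewrite /= invr_ge0 ltW//= lef_pV2 ?posrE//.
  by nra.
Unshelve. all: by end_near. Qed.

Lemma integral_kernel2 :
  (\int[leb]_(s in `]0%R, +oo[) ((s ^+ 2 + 1) / (1 + s ^+ 2) ^+ 2)%:E = (pi / 2)%:E)%E.
Proof.
rewrite integral_itv_obnd_cbnd; last first.
  apply/measurable_EFinP/measurable_funTS; apply: continuous_measurable_fun => x.
  apply: (@cvg_trans _ ((1 + s ^+ 2)^-1 @[s --> x])); last first.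
    have -> : (x ^+ 2 + 1) / (1 + x ^+ 2) ^+ 2 = (1 + x ^+ 2)^-1 :> R.
      by have nz := onePsqr_neq0 x; field.
    exact: cvg_onePsqrV.
  apply: near_eq_cvg; near=> s; have nz := onePsqr_neq0 s; by field.
rewrite -integral0y_oneDsqr; apply: eq_integral => s _; congr (_%:E).
by rewrite /oneDsqr; have nz := onePsqr_neq0 s; field.
Unshelve. all: by end_near. Qed.

Lemma cvg0_mul_ln : (x * ln x : R) @[x --> (0 : R)^'+] --> (0 : R).
Proof.
apply: norm_cvg0.
apply: (@squeeze_cvgr _ _ _ _ (cst 0) (fun x => 2 * (x * Num.sqrt x + Num.sqrt x))).
- near=> x; have x0 : 0 < x by near: x; exact: nbhs_right_gt.
  have s0 : 0 < Num.sqrt x by rewrite sqrtr_gt0.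
  rewrite /= normr_ge0/= normrM gtr0_norm//.
  have h : x * `|ln x| <= x * (2 * (Num.sqrt x + (Num.sqrt x)^-1)).
    by rewrite ler_wpM2l ?abs_ln_le_sqrt// ltW.
  rewrite (le_trans h)//.
  rewrite le_eqVlt; apply/orP; left; apply/eqP.
  have e := sqr_sqrtr (ltW x0); move: (Num.sqrt x) e s0 {h} => r <- r0.
  by field; rewrite gt_eqF.
- exact: cvg_cst.
- rewrite -[X in _ --> X](_ : 2 * (0 * Num.sqrt 0 + Num.sqrt 0) = 0 :> R); last first.
    by rewrite sqrtr0 mul0r addr0 mulr0.
  apply: cvg_at_right_filter; apply: cvgMl_tmp; apply: cvgD; last exact: sqrt_continuous.
  by apply: cvgM; [exact: cvg_id|exact: sqrt_continuous].
Unshelve. all: by end_near. Qed.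

(** The value is that of [integral_kernel2], so the logarithmic term contributes nothing:
    [s -> 1 / s] changes its sign. Adding [s ^+ 2 + 1] makes the integrand nonnegative, as
    [ge0_FTC0y] requires. *)
Lemma integral_kernel3 :
  (\int[leb]_(s in `]0%R, +oo[) ((s * ln s + s ^+ 2 + 1) / (1 + s ^+ 2) ^+ 2)%:E
   = (pi / 2)%:E)%E.
Proof.
(* Integration by parts with the primitive [s^2 / (2 (1 + s^2))] of [s / (1 + s^2)^2]. This
   primitive vanishes at [0] to second order, which kills the boundary term there; [atan] integrates
   the added part. *)
pose F (s : R) := 1 / 2 * (s ^+ 2 * ln s) * (1 + s ^+ 2)^-1 - 1 / 4 * ln (1 + s ^+ 2) + atan s.
have F0 : F 0 = 0 by rewrite /F expr0n/= mul0r mulr0 mul0r addr0 ln1 mulr0 subrr atan0 addr0.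
have cvgV2 (x : R) : ((1 + s ^+ 2) ^+ 2)^-1 @[s --> x] --> (((1 + x ^+ 2) ^+ 2)^-1 : R).
  under eq_fun do rewrite -exprVn.
  rewrite -exprVn; exact: cvg_sqr (cvg_onePsqrV x).
have csqr (x : R) : (s ^+ 2 : R) @[s --> x] --> x ^+ 2 by exact: cvg_sqr cvg_id.
have cln1 (x : R) : ln (1 + s ^+ 2) @[s --> x] --> (ln (1 + x ^+ 2) : R).
  apply: (@continuous_cvg _ _ _ _ _ (fun s : R => 1 + s ^+ 2)); first exact: continuous_ln.
  by apply: cvgD; [exact: cvg_cst|exact: csqr].
have dF (x : R) : 0 < x -> is_derive x 1 F ((x * ln x + x ^+ 2 + 1) / (1 + x ^+ 2) ^+ 2).
  move=> x0; have nz := onePsqr_neq0 x; have nx : x != 0 by rewrite gt_eqF.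
  have H1 := is_derive1_ln x0; have H2 := is_derive1_ln (onePsqr_gt0 x).
  by apply: is_derive_eq; rewrite /GRing.scale/=; field; rewrite ?nx ?nz.
rewrite (_ : (pi / 2)%:E = (pi / 2 - F 0)%:E); last by rewrite F0 subr0.
apply: ge0_FTC0y => //.
- move=> x; rewrite le_eqVlt => /predU1P[<-|x0].
    by rewrite mul0r add0r expr0n/= addr0 add0r divr_ge0// sqr_ge0.
  rewrite divr_ge0 ?sqr_ge0//.
  have y0 : 0 < x^-1 by rewrite invr_gt0.
  have := ln_sublinear y0; rewrite lnV ?posrE// => /ltW h1.
  have : x * - ln x <= x * x^-1 by rewrite ler_wpM2l// ltW.
  rewrite divff ?gt_eqF//; have := sqr_ge0 x; lra.
- apply: cvgM; last exact: cvg_at_right_filter (cvgV2 0).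
  rewrite mul0r; apply: cvgD; last exact: cvg_cst.
  by apply: cvgD; [exact: cvg0_mul_ln|apply: cvg_at_right_filter; exact: csqr].
- rewrite /F; apply: cvgD; last by apply: cvg_at_right_filter; exact: continuous_atan.
  apply: cvgB; last by apply: cvg_at_right_filter; apply: cvgMl_tmp; exact: cln1.
  apply: cvgM; last by apply: cvg_at_right_filter; exact: cvg_onePsqrV.
  apply: cvgMl_tmp; rewrite expr0n/= mul0r.
  have h : (s * (s * ln s) : R) @[s --> (0 : R)^'+] --> (0 * 0 : R).
    by apply: cvgM; [apply: cvg_at_right_filter; exact: cvg_id|exact: cvg0_mul_ln].
  by rewrite mul0r in h; under eq_fun do rewrite expr2 -mulrA.
- move=> x x0; apply: cvgM; last exact: cvgV2.
  apply: cvgD; last exact: cvg_cst.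
  apply: cvgD; last exact: csqr.
  by apply: cvgM; [exact: cvg_id|exact: continuous_ln].
- apply: (@squeeze_cvgr _ _ _ _ (fun x => atan x - x^-1) atan); last 2 first.
  + rewrite -[X in _ --> X]subr0; apply: cvgB; [exact: cvgy_atan|exact: cvgy_inv].
  + exact: cvgy_atan.
  near=> x; have x1 : 1 <= x by near: x; exact: nbhs_pinfty_ge.
  have x0 : 0 < x by rewrite (lt_le_trans ltr01).
  have xV0 : 0 < x^-1 by rewrite invr_gt0.
  (* The first two terms of [F] each diverge like [(1 / 2) ln x]. Extracting [2 * ln x] cancels the
     divergence and leaves two nonnegative errors of total at most [x^-1]. *)
  have E : ln (1 + x ^+ 2) = ln (1 + (x^-1) ^+ 2) + 2 * ln x.
    rewrite mulr_natl -lnXn// -lnM ?posrE ?exprn_gt0//; congr ln.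
    by field; rewrite gt_eqF.
  have -> : F x = atan x - 1 / 4 * ln (1 + (x^-1) ^+ 2) - 1 / 2 * (ln x / (1 + x ^+ 2)).
    by rewrite /F E; field; exact: onePsqr_neq0.
  have l1 : 0 <= ln (1 + (x^-1) ^+ 2) by apply: ln_ge0; rewrite lerDl sqr_ge0.
  have l2 : ln (1 + (x^-1) ^+ 2) <= (x^-1) ^+ 2.
    by apply: le_ln1Dx; rewrite (lt_le_trans _ (sqr_ge0 _))// ltrN10.
  have l3 : (x^-1) ^+ 2 <= x^-1 by rewrite expr2 ler_piMl ?invf_le1// ltW.
  have l4 : 0 <= ln x / (1 + x ^+ 2) by rewrite divr_ge0 ?ln_ge0// ltW.
  have l5 : ln x / (1 + x ^+ 2) <= x^-1.
    rewrite ler_pdivrMr// (le_trans (ltW (ln_sublinear x0)))//.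
    by rewrite mulrDr mulr1 expr2 mulKf ?gt_eqF// lerDr ltW.
  by apply/andP; split; lra.
Unshelve. all: by end_near. Qed.

End kernel_integrals.

Lemma measurable_invr (R : realType) : measurable_fun [set: R] (@GRing.inv R).
Proof.
have -> : [set: R] = [set 0] `|` ~` [set 0] by rewrite setUv.
apply/measurable_funU => //; first exact: measurableC.
split; first exact: measurable_fun_set1.
apply: open_continuous_measurable_fun; first exact/closed_openC/closed_eq.
by move=> x; rewrite inE/= => /eqP x0; exact: inv_continuous.
Qed.

Lemma measurable_sqrtr (R : realType) : measurable_fun [set: R] (@Num.sqrt R).
Proof. by apply: continuous_measurable_fun; exact: sqrt_continuous. Qed.

(** * The spherical density and its radial moments *)

Section kernel.
Context {R : realType}.
Local Notation leb := (@lebesgue_measure R).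
Local Notation leb2 := (leb \x leb)%E.

Definition norm2 (p : R * R) : R := Num.sqrt (p.1 ^+ 2 + p.2 ^+ 2).

(* Density of the Fubini-Study area form, normalised to a probability. *)
Definition kernel (p : R * R) : R := (pi * (1 + norm2 p ^+ 2) ^+ 2)^-1.

Lemma norm2_ge0 p : 0 <= norm2 p. Proof. exact: sqrtr_ge0. Qed.

Lemma sqr_norm2 p : norm2 p ^+ 2 = p.1 ^+ 2 + p.2 ^+ 2.
Proof. by rewrite sqr_sqrtr// addr_ge0// sqr_ge0. Qed.

Lemma kernel_ge0 p : 0 <= kernel p.
Proof. by rewrite invr_ge0 mulr_ge0 ?pi_ge0// sqr_ge0. Qed.

Lemma measurable_norm2 : measurable_fun setT norm2.
Proof.
apply: (measurableT_comp (measurable_sqrtr R)).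
by apply: measurable_funD; apply: measurable_funX.
Qed.

Lemma measurable_kernel : measurable_fun setT kernel.
Proof.
apply: (measurableT_comp (measurable_invr R)); apply: measurable_funM => //.
apply: measurable_funX; apply: measurable_funD => //.
by apply: measurable_funX; exact: measurable_norm2.
Qed.

(** The [2 * pi] of polar coordinates meets the [1 / pi] of [kernel], leaving [2]. The function [g1]
    is a simplified form of the radial integrand, which need agree with it only for [s > 0]. *)
Lemma ge0_integral_norm2_kernel (g g1 : R -> R) : measurable_fun setT g ->
  (forall r, 0 <= r -> 0 <= g r) ->
  (forall s, 0 < s -> s * g s / (1 + s ^+ 2) ^+ 2 = g1 s) ->
  (\int[leb2]_p (g (norm2 p) * kernel p)%:E =
   2%:E * \int[leb]_(s in `]0%R, +oo[) (g1 s)%:E)%E.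
Proof.
move=> mg g0 g1E.
pose h r := g (Num.sqrt r) * (pi * (1 + r) ^+ 2)^-1.
have h0 r : 0 <= h r.
  by rewrite mulr_ge0 ?g0 ?sqrtr_ge0// invr_ge0 mulr_ge0 ?pi_ge0// sqr_ge0.
have mh : measurable_fun setT h.
  apply: measurable_funM.
    exact: (measurableT_comp mg (measurable_sqrtr R)).
  apply: (measurableT_comp (measurable_invr R)); apply: measurable_funM => //.
  by apply: measurable_funX; apply: measurable_funD.
rewrite (_ : (\int[leb2]_p _ = \int[leb2]_p (h (p.1 ^+ 2 + p.2 ^+ 2))%:E)%E); last first.
  by apply: eq_integral => p _; rewrite /h /kernel sqr_norm2.
rewrite ge0_integral_radial// EFinM -muleA; congr (_ * _)%E.
have ms (f : R -> R) : measurable_fun setT f ->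
    measurable_fun (`]0%R, +oo[%classic : set R) (fun x : R => (f x)%:E).
  by move=> mf; apply/measurable_EFinP/measurable_funTS.
rewrite -ge0_integralZl//; last 3 first.
- by apply: ms; apply: measurable_funM => //; apply: measurableT_comp.
- by move=> s /=; rewrite in_itv/= andbT lee_fin => s0; rewrite mulr_ge0// ltW.
- by rewrite lee_fin pi_ge0.
apply: eq_integral => s; rewrite inE/= in_itv/= andbT => s0.
rewrite -EFinM -g1E// /h sqrtr_sqr gtr0_norm//; congr (_%:E).
have nz := onePsqr_neq0 (s : R); have := pi_gt0 R; move: (@pi R) => q q0.
by field; rewrite nz gt_eqF.
Qed.

Lemma integral_kernel : (\int[leb2]_p (kernel p)%:E = 1)%E.
Proof.
rewrite (_ : (\int[leb2]_p _ = \int[leb2]_p (1 * kernel p)%:E)%E); last first.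
  by apply: eq_integral => p _; rewrite mul1r.
rewrite (@ge0_integral_norm2_kernel (cst 1) (fun s => s / (1 + s ^+ 2) ^+ 2))//; last first.
  by move=> s _; rewrite mulr1.
by rewrite integral_kernel1 -EFinM mulrC divfK.
Qed.

Let id_inv_ge0 (r : R) : 0 <= r -> 0 <= r + r^-1.
Proof. by move=> r0; rewrite addr_ge0// invr_ge0. Qed.

Let measurable_id_inv : measurable_fun setT (fun r : R => r + r^-1).
Proof. by apply: measurable_funD => //; exact: measurable_invr. Qed.

Lemma integral_inv_norm2_kernel :
  (\int[leb2]_p ((norm2 p + (norm2 p)^-1) * kernel p)%:E = pi%:E)%E.
Proof.
rewrite (@ge0_integral_norm2_kernel (fun r => r + r^-1)
  (fun s => (s ^+ 2 + 1) / (1 + s ^+ 2) ^+ 2))//; last first.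
  by move=> s s0; rewrite mulrDr divff ?gt_eqF.
by rewrite integral_kernel2 -EFinM mulrC divfK.
Qed.

Lemma integrable_inv_norm2_kernel : leb2.-integrable setT
  (fun p => ((norm2 p + (norm2 p)^-1) * kernel p)%:E).
Proof.
apply/integrableP; split.
  apply/measurable_EFinP; apply: measurable_funM; last exact: measurable_kernel.
  exact: (measurableT_comp measurable_id_inv measurable_norm2).
rewrite (_ : (\int[leb2]_p _ = \int[leb2]_p ((norm2 p + (norm2 p)^-1) * kernel p)%:E)%E).
  by rewrite integral_inv_norm2_kernel ltry.
apply: eq_integral => p _; rewrite gee0_abs// lee_fin.
by rewrite mulr_ge0 ?kernel_ge0 ?id_inv_ge0 ?norm2_ge0.
Qed.

(** The radial formula accepts only nonnegative integrands, so the logarithm is written as a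
    difference of two such functions by adding and subtracting [r + r^-1]; both integrals equal
    [pi]. At [r = 0] positivity rests on the conventions [ln 0 = 0] and [0^-1 = 0]. *)
Lemma integral_ln_norm2_kernel : (\int[leb2]_p (ln (norm2 p) * kernel p)%:E = 0)%E.
Proof.
have mid : measurable_fun setT (fun r : R => ln r + (r + r^-1)).
  by apply: measurable_funD => //; exact: measurable_ln.
have id0 (r : R) : 0 <= r -> 0 <= ln r + (r + r^-1).
  rewrite le_eqVlt => /predU1P[<-|r0]; first by rewrite ln0// invr0 !addr0.
  by have := abs_ln_le _ r0; rewrite ler_norml => /andP[]; lra.
pose W1 (p : R * R) : \bar R := ((ln (norm2 p) + (norm2 p + (norm2 p)^-1)) * kernel p)%:E.
pose W2 (p : R * R) : \bar R := ((norm2 p + (norm2 p)^-1) * kernel p)%:E.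
have I1 : (\int[leb2]_p W1 p = pi%:E)%E.
  rewrite /W1 (@ge0_integral_norm2_kernel (fun r => ln r + (r + r^-1))
    (fun s => (s * ln s + s ^+ 2 + 1) / (1 + s ^+ 2) ^+ 2))//; last first.
    by move=> s s0; rewrite !mulrDr divff ?gt_eqF// addrA.
  by rewrite integral_kernel3 -EFinM mulrC divfK.
have i1 : leb2.-integrable setT W1.
  apply/integrableP; split.
    apply/measurable_EFinP; apply: measurable_funM; last exact: measurable_kernel.
    exact: (measurableT_comp mid measurable_norm2).
  rewrite (_ : (\int[leb2]_p _ = \int[leb2]_p W1 p)%E); first by rewrite I1 ltry.
  apply: eq_integral => p _; rewrite gee0_abs// lee_fin.
  by rewrite mulr_ge0 ?kernel_ge0 ?id0 ?norm2_ge0.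
rewrite (_ : (\int[leb2]_p _ = \int[leb2]_p (W1 p - W2 p))%E); last first.
  by apply: eq_integral => p _; rewrite /W1 /W2 -EFinB -mulrBl addrK.
rewrite integralB//; last exact: integrable_inv_norm2_kernel.
by rewrite I1 integral_inv_norm2_kernel -EFinB subrr.
Qed.

End kernel.

(** * Smooth test functions on the sphere *)

Section smoothness.
Context {R : realType}.
Implicit Types (f g : R * R -> R) (p v : R * R).

(** A class closed under directional derivatives, so that smoothness of every order, continuity and
    measurability all follow by induction. Positivity on the whole plane is demanded for inverses
    and logarithms, so differentiation creates no new side condition. *)
Inductive smooth_expr : (R * R -> R) -> Prop :=
| se_cst c : smooth_expr (fun=> c)
| se_fst : smooth_expr (fun p => p.1)
| se_snd : smooth_expr (fun p => p.2)
| se_add f g : smooth_expr f -> smooth_expr g -> smooth_expr (fun p => f p + g p)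
| se_mul f g : smooth_expr f -> smooth_expr g -> smooth_expr (fun p => f p * g p)
| se_inv f : smooth_expr f -> (forall p, 0 < f p) -> smooth_expr (fun p => (f p)^-1)
| se_ln f : smooth_expr f -> (forall p, 0 < f p) -> smooth_expr (fun p => ln (f p)).

(** A directional derivative is the derivative at [0] of the restriction to a line, which brings the
    one-variable chain rule within reach. *)
Lemma is_derive_lineP f p v (d : R) :
  is_derive p v f d <-> is_derive (0 : R) (1 : R) (fun h => f (h *: v + p)) d.
Proof.
have E : 'D_v f p = 'D_1 (fun h : R => f (h *: v + p)) 0.
  rewrite /derive; set g1 := fun h => h^-1 *: _; set g2 := fun h => h^-1 *: _.
  suff -> : g1 = g2 by [].
  by apply/funext => h; rewrite /g1 /g2/= addr0 scale0r add0r [_%:A]mulr1.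
split=> -[D <-]; apply: DeriveDef; rewrite ?E//.
- exact: (derivable1P f p v).1 D.
- exact: (derivable1P f p v).2 D.
Qed.

Lemma is_derive_ln f p v (d : R) : 0 < f p -> is_derive p v f d ->
  is_derive p v (fun q => ln (f q)) ((f p)^-1 * d).
Proof.
move=> fp /is_derive_lineP df; apply/is_derive_lineP.
have f0 : f (0 *: v + p) = f p by rewrite scale0r add0r.
have H : is_derive (f (0 *: v + p)) 1 (@ln R) (f p)^-1 by rewrite f0; exact: is_derive1_ln.
exact: (@is_derive1_comp R (@ln R) (fun h => f (h *: v + p)) 0 _ _ H df).
Qed.

Lemma is_derive_inv f p v (d : R) : 0 < f p -> is_derive p v f d ->
  is_derive p v (fun q => (f q)^-1) (- ((f p)^-1 * (f p)^-1) * d).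
Proof.
move=> fp [df <-]; have nz : f p != 0 by rewrite gt_eqF.
by apply: DeriveDef; [exact: derivableV|rewrite deriveV// expr2 invfM].
Qed.

Lemma is_derive_fst p v : is_derive p v (fun q : R * R => q.1) v.1.
Proof.
apply/is_derive_lineP => /=.
have -> : (fun h : R => h * v.1 + p.1) = (fun h : R => v.1 * h + p.1).
  by apply/funext => h; rewrite mulrC.
by apply: is_derive_eq; rewrite /GRing.scale/=; ring.
Qed.

Lemma is_derive_snd p v : is_derive p v (fun q : R * R => q.2) v.2.
Proof.
apply/is_derive_lineP => /=.
have -> : (fun h : R => h * v.2 + p.2) = (fun h : R => v.2 * h + p.2).
  by apply/funext => h; rewrite mulrC.
by apply: is_derive_eq; rewrite /GRing.scale/=; ring.
Qed.

Lemma smooth_expr_derive f v : smooth_expr f ->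
  exists2 g, smooth_expr g & forall p, is_derive p v f (g p).
Proof.
elim=> {f} [c|||f g sf [df sdf dfE] sg [dg sdg dgE]|f g sf [df sdf dfE] sg [dg sdg dgE]
  |f sf [df sdf dfE] f0|f sf [df sdf dfE] f0].
- by exists (fun=> 0); [exact: se_cst|move=> p; exact: is_derive_cst].
- by exists (fun=> v.1); [exact: se_cst|move=> p; exact: is_derive_fst].
- by exists (fun=> v.2); [exact: se_cst|move=> p; exact: is_derive_snd].
- exists (fun p => df p + dg p); first exact: se_add.
  by move=> p; have := dfE p; have := dgE p => *; exact: is_deriveD.
- exists (fun p => f p * dg p + g p * df p); first by apply: se_add; exact: se_mul.
  by move=> p; have := dfE p; have := dgE p => *; exact: is_deriveM.
- exists (fun p => (-1 * ((f p)^-1 * (f p)^-1)) * df p).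
    apply: se_mul => //; apply: se_mul; first exact: se_cst.
    by apply: se_mul; exact: se_inv.
  by move=> p; rewrite mulN1r; exact: is_derive_inv.
- exists (fun p => (f p)^-1 * df p); first by apply: se_mul => //; exact: se_inv.
  by move=> p; exact: is_derive_ln.
Qed.

Lemma smooth_expr_continuous f : smooth_expr f -> continuous f.
Proof.
elim=> {f} [c|||f g sf cf sg cg|f g sf cf sg cg|f sf cf f0|f sf cf f0] p.
- exact: cvg_cst.
- exact: cvg_fst.
- exact: cvg_snd.
- by apply: cvgD; [exact: cf|exact: cg].
- by apply: cvgM; [exact: cf|exact: cg].
- by apply: cvgV; [rewrite gt_eqF|exact: cf].
- by apply: continuous_cvg; [exact: continuous_ln|exact: cf].
Qed.

Lemma smooth_expr_smooth f : smooth_expr f -> smooth f.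
Proof.
move=> sf k; elim: k f sf => [|k IH] f sf /=; first exact: smooth_expr_continuous.
have [g1 s1 d1] := smooth_expr_derive f (1, 0) sf.
have [g2 s2 d2] := smooth_expr_derive f (0, 1) sf.
split.
- by move=> p; have [] := d1 p.
- by move=> p; have [] := d2 p.
- by have -> : 'D_(1, 0) f = g1; [apply/funext => p; have [] := d1 p|exact: IH].
- by have -> : 'D_(0, 1) f = g2; [apply/funext => p; have [] := d2 p|exact: IH].
Qed.

Definition quad (z : R * R) (s : R) p : R :=
  1 + s ^+ 2 * ((p.1 - z.1) ^+ 2 + (p.2 - z.2) ^+ 2).

Lemma quad_ge1 z s p : 1 <= quad z s p.
Proof. by rewrite lerDl mulr_ge0 ?addr_ge0 ?sqr_ge0. Qed.

Lemma quad_gt0 z s p : 0 < quad z s p.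
Proof. exact: lt_le_trans (quad_ge1 z s p). Qed.

Lemma is_derive_quad z s p v : is_derive p v (quad z s)
  (s ^+ 2 * (2 * (p.1 - z.1) * v.1 + 2 * (p.2 - z.2) * v.2)).
Proof.
have H1 := is_derive_fst p v; have H2 := is_derive_snd p v.
by apply: is_derive_eq; rewrite /GRing.scale/=; ring.
Qed.

Lemma is_derive_half_ln_quad z s p v : is_derive p v (fun p => 1 / 2 * ln (quad z s p))
  (s ^+ 2 * ((p.1 - z.1) * v.1 + (p.2 - z.2) * v.2) / quad z s p).
Proof.
have H := is_derive_ln _ _ _ _ (quad_gt0 z s p) (is_derive_quad z s p v).
by apply: is_derive_eq; rewrite /GRing.scale/=; field; rewrite gt_eqF ?quad_gt0.
Qed.

Lemma is_derive_half_ln_quad2 z s p v : is_derive p v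
  (fun p => s ^+ 2 * ((p.1 - z.1) * v.1 + (p.2 - z.2) * v.2) / quad z s p)
  (s ^+ 2 * (v.1 ^+ 2 + v.2 ^+ 2) / quad z s p -
   2 * (s ^+ 2 * ((p.1 - z.1) * v.1 + (p.2 - z.2) * v.2) / quad z s p) ^+ 2).
Proof.
have H1 := is_derive_fst p v; have H2 := is_derive_snd p v.
have H := is_derive_inv _ _ _ _ (quad_gt0 z s p) (is_derive_quad z s p v).
by apply: is_derive_eq; rewrite /GRing.scale/=; field; rewrite gt_eqF ?quad_gt0.
Qed.

(** Write [q = 1 + s^2 rho^2]. Summing the second derivatives of [(1 / 2) ln q] over both axes gives
    [2 s^2 (q - s^2 rho^2) / q^2], and the bracket is [1]. *)
Lemma laplacian_ln_quad z c s t p :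
  laplacian (fun p => c + (1 / 2 * ln (quad z s p) - 1 / 2 * ln (quad z t p))) p =
  2 * s ^+ 2 / quad z s p ^+ 2 - 2 * t ^+ 2 / quad z t p ^+ 2.
Proof.
have D1 v : 'D_v (fun p => c + (1 / 2 * ln (quad z s p) - 1 / 2 * ln (quad z t p))) =
    fun p => s ^+ 2 * ((p.1 - z.1) * v.1 + (p.2 - z.2) * v.2) / quad z s p -
             t ^+ 2 * ((p.1 - z.1) * v.1 + (p.2 - z.2) * v.2) / quad z t p.
  apply/funext => q; have H1 := is_derive_half_ln_quad z s q v.
  have H2 := is_derive_half_ln_quad z t q v.
  by apply: derive_val; apply: is_derive_eq; rewrite add0r.
have D2 v q : 'D_v ('D_v (fun p => c + (1 / 2 * ln (quad z s p) - 1 / 2 * ln (quad z t p)))) q =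
   (s ^+ 2 * (v.1 ^+ 2 + v.2 ^+ 2) / quad z s q -
   2 * (s ^+ 2 * ((q.1 - z.1) * v.1 + (q.2 - z.2) * v.2) / quad z s q) ^+ 2) -
   (t ^+ 2 * (v.1 ^+ 2 + v.2 ^+ 2) / quad z t q -
   2 * (t ^+ 2 * ((q.1 - z.1) * v.1 + (q.2 - z.2) * v.2) / quad z t q) ^+ 2).
  rewrite D1; have H1 := is_derive_half_ln_quad2 z s q v.
  have H2 := is_derive_half_ln_quad2 z t q v.
  exact: derive_val.
rewrite /laplacian !D2/=.
have q1 := quad_gt0 z s p; have q2 := quad_gt0 z t p.
set x := p.1 - z.1; set y := p.2 - z.2.
have E1 : s ^+ 2 * (x ^+ 2 + y ^+ 2) = quad z s p - 1 by rewrite /quad -/x -/y; ring.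
have E2 : t ^+ 2 * (x ^+ 2 + y ^+ 2) = quad z t p - 1 by rewrite /quad -/x -/y; ring.
move: (quad z s p) (quad z t p) q1 q2 E1 E2 => a b a0 b0 E1 E2.
transitivity (2 * s ^+ 2 * (a - s ^+ 2 * (x ^+ 2 + y ^+ 2)) / a ^+ 2
            - 2 * t ^+ 2 * (b - t ^+ 2 * (x ^+ 2 + y ^+ 2)) / b ^+ 2).
  by field; rewrite !gt_eqF.
by rewrite E1 E2 !subKr !mulr1.
Qed.

End smoothness.

(** * The test functions in both charts of the sphere *)

Section test_function.
Context {R : realType}.
Local Notation C := (R[i]%C).

Definition ofC (w : C) : R * R := (complex.Re w, complex.Im w).

Lemma ofCK (w : C) : toC (ofC w) = w. Proof. by case: w. Qed.
Lemma toCK (p : R * R) : ofC (toC p) = p. Proof. by case: p. Qed.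

(* A smooth function on the sphere approximating [log |w - z|] away from infinity; its Laplacian
   is the difference of two rescaled copies of [kernel], centred at [z]. *)
Definition test (z : R * R) (e t : R) (x : P1 R) : R :=
  if x is Some w
  then ln e + (1 / 2 * ln (quad z e^-1 (ofC w)) - 1 / 2 * ln (quad z t (ofC w)))
  else - ln t.

(** With [u = toC p], this is [|u|^2 + s^2 |1 - u z|^2]: the function [quad] at [1 / u], cleared of
    its denominator [|u|^2]. *)
Let quad_infty (z : R * R) (s : R) (p : R * R) : R := (p.1 ^+ 2 + p.2 ^+ 2) +
  s ^+ 2 * ((1 - (p.1 * z.1 - p.2 * z.2)) ^+ 2 + (p.1 * z.2 + p.2 * z.1) ^+ 2).

Let quad_infty_gt0 z s p : 0 < s -> 0 < quad_infty z s p.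
Proof.
move=> s0; have [->|p0] := eqVneq p (0, 0).
  by rewrite /quad_infty/= !mul0r subrr addr0 subr0 expr1n expr0n/= !add0r addr0 mulr1 exprn_gt0.
apply: ltr_pwDl; last by rewrite mulr_ge0 ?addr_ge0 ?sqr_ge0.
rewrite lt_neqAle addr_ge0 ?sqr_ge0// andbT eq_sym paddr_eq0 ?sqr_ge0// !sqrf_eq0.
by case: p p0 => x y; rewrite xpair_eqE.
Qed.

Let quad_inftyE z s p : p != (0, 0) ->
  quad z s (ofC (1 / toC p)) = quad_infty z s p / (p.1 ^+ 2 + p.2 ^+ 2).
Proof.
move=> p0; have n0 : 0 < p.1 ^+ 2 + p.2 ^+ 2.
  rewrite lt_neqAle addr_ge0 ?sqr_ge0// andbT eq_sym paddr_eq0 ?sqr_ge0// !sqrf_eq0.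
  by case: p p0 => x y; rewrite xpair_eqE.
have c0 : toC p != 0 by case: p p0 {n0} => x y; rewrite eq_complex xpair_eqE.
(* The real and imaginary parts of [u * (1 / u) = 1] stand in for an explicit formula for the
   inverse. *)
have := mulfV c0; rewrite -[(toC p)^-1]mul1r.
case: (1 / toC p) => u v; rewrite /toC => -[E1 E2]; rewrite /quad /quad_infty /=.
have -> : p.1 * z.2 + p.2 * z.1 = - ((p.1 * v + p.2 * u) - (p.1 * z.2 + p.2 * z.1)).
  by rewrite E2; ring.
have -> : 1 - (p.1 * z.1 - p.2 * z.2) = p.1 * u - p.2 * v - (p.1 * z.1 - p.2 * z.2).
  by rewrite E1.
by field; rewrite gt_eqF.
Qed.

Let smooth_expr_sqr f : smooth_expr f -> smooth_expr (fun p : R * R => f p ^+ 2).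
Proof. by move=> sf; under eq_fun do rewrite expr2; exact: se_mul. Qed.

Let smooth_expr_sub f g : smooth_expr f -> smooth_expr g ->
  smooth_expr (fun p : R * R => f p - g p).
Proof.
move=> sf sg; under eq_fun do rewrite -mulN1r.
by apply: se_add => //; apply: se_mul => //; exact: se_cst.
Qed.

Lemma smooth_expr_quad (z : R * R) (s : R) : smooth_expr (quad z s).
Proof.
apply: se_add; first exact: se_cst.
apply: se_mul; first exact: se_cst.
by apply: se_add; apply: smooth_expr_sqr; apply: smooth_expr_sub;
  [exact: se_fst|exact: se_cst|exact: se_snd|exact: se_cst].
Qed.

Let smooth_expr_quad_infty (z : R * R) (s : R) : smooth_expr (quad_infty z s).
Proof.
have l a b : smooth_expr (fun p : R * R => p.1 * a + p.2 * b).
  by apply: se_add; apply: se_mul; [exact: se_fst|exact: se_cst|exact: se_snd|exact: se_cst].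
apply: se_add.
  by apply: se_add; apply: smooth_expr_sqr; [exact: se_fst|exact: se_snd].
apply: se_mul; first exact: se_cst.
apply: se_add; apply: smooth_expr_sqr; last exact: l.
apply: smooth_expr_sub; first exact: se_cst.
by under eq_fun do rewrite -mulrN; exact: l.
Qed.

Let smooth_expr_ln_sub (c : R) f g : smooth_expr f -> smooth_expr g ->
  (forall p, 0 < f p) -> (forall p, 0 < g p) ->
  smooth_expr (fun p : R * R => c + (1 / 2 * ln (f p) - 1 / 2 * ln (g p))).
Proof.
move=> sf sg f0 g0; apply: se_add; first exact: se_cst.
by apply: smooth_expr_sub; apply: se_mul; [exact: se_cst|exact: se_ln|exact: se_cst|exact: se_ln].
Qed.

(** In the chart at infinity both logarithms carry the same singular term [- ln |p|^2], which drops
    out of the difference. At the origin of that chart [quad_infty] equals [s ^+ 2], whence the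
    value [ln e + ln e^-1 - ln t = - ln t]. *)
Lemma smoothP1_test (z : R * R) (e t : R) : 0 < e -> 0 < t -> smoothP1 (test z e t).
Proof.
move=> e0 t0; have e1 : 0 < e^-1 by rewrite invr_gt0.
split; apply: smooth_expr_smooth.
- rewrite (_ : (fun p => _) =
    fun p => ln e + (1 / 2 * ln (quad z e^-1 p) - 1 / 2 * ln (quad z t p))).
    by apply: smooth_expr_ln_sub; [exact: smooth_expr_quad|exact: smooth_expr_quad
                                  |exact: quad_gt0|exact: quad_gt0].
  by apply/funext => p; rewrite /Defs.proj oner_eq0 divr1 /= toCK.
- rewrite (_ : (fun p => _) =
    fun p => ln e + (1 / 2 * ln (quad_infty z e^-1 p) - 1 / 2 * ln (quad_infty z t p))).
    by apply: smooth_expr_ln_sub; [exact: smooth_expr_quad_infty|exact: smooth_expr_quad_infty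
      |move=> p; exact: quad_infty_gt0|move=> p; exact: quad_infty_gt0].
  apply/funext => p; rewrite /Defs.proj.
  have [->|p0] := eqVneq p (0, 0).
    rewrite /toC/= eqxx /quad_infty/= !mul0r subrr addr0 subr0 expr1n expr0n/= !add0r addr0 !mulr1.
    by rewrite !lnXn// lnV ?posrE//; lra.
  have n0 : 0 < p.1 ^+ 2 + p.2 ^+ 2.
    rewrite lt_neqAle addr_ge0 ?sqr_ge0// andbT eq_sym paddr_eq0 ?sqr_ge0// !sqrf_eq0.
    by case: p p0 => x y; rewrite xpair_eqE.
  rewrite [_ == 0](_ : _ = false); last first.
    by apply/negbTE; case: p p0 {n0} => x y; rewrite eq_complex xpair_eqE.
  rewrite /test !quad_inftyE// !ln_div ?posrE ?quad_infty_gt0//.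
  lra.
Qed.

End test_function.

(** * The Green function of a lift *)

Section complex_expr.
Context {R : realType}.
Local Notation C := (R[i]%C).
Implicit Types (h k : R * R -> C).

Definition smooth_cexpr h :=
  smooth_expr (fun p => complex.Re (h p)) /\ smooth_expr (fun p => complex.Im (h p)).

Lemma smooth_cexpr_cst (c : C) : smooth_cexpr (fun=> c).
Proof. by split; exact: se_cst. Qed.

Lemma smooth_cexpr_add h k : smooth_cexpr h -> smooth_cexpr k ->
  smooth_cexpr (fun p => h p + k p).
Proof.
move=> [h1 h2] [k1 k2]; split.
- rewrite (_ : (fun _ => _) = fun p => complex.Re (h p) + complex.Re (k p)); first exact: se_add.
  by apply/funext => p; case: (h p) => ? ?; case: (k p).
- rewrite (_ : (fun _ => _) = fun p => complex.Im (h p) + complex.Im (k p)); first exact: se_add.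
  by apply/funext => p; case: (h p) => ? ?; case: (k p).
Qed.

Lemma smooth_cexpr_mul h k : smooth_cexpr h -> smooth_cexpr k ->
  smooth_cexpr (fun p => h p * k p).
Proof.
move=> [h1 h2] [k1 k2]; split.
- rewrite (_ : (fun _ => _) = fun p => complex.Re (h p) * complex.Re (k p) +
    -1 * (complex.Im (h p) * complex.Im (k p))).
    by apply: se_add; [|apply: se_mul; first exact: se_cst]; exact: se_mul.
  by apply/funext => p; case: (h p) => ? ?; case: (k p) => ? ?; rewrite mulN1r.
- rewrite (_ : (fun _ => _) = fun p => complex.Re (h p) * complex.Im (k p) +
    complex.Im (h p) * complex.Re (k p)); first by apply: se_add; exact: se_mul.
  by apply/funext => p; case: (h p) => ? ?; case: (k p).
Qed.

Lemma smooth_cexpr_exp h n : smooth_cexpr h -> smooth_cexpr (fun p => h p ^+ n).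
Proof.
move=> sh; elim: n => [|n IH]; first exact: smooth_cexpr_cst.
by under eq_fun do rewrite exprS; exact: smooth_cexpr_mul.
Qed.

Lemma smooth_cexpr_sum n (h : 'I_n -> R * R -> C) : (forall i, smooth_cexpr (h i)) ->
  smooth_cexpr (fun p => \sum_(i < n) h i p).
Proof.
elim: n h => [|n IH] h sh.
  by under eq_fun do rewrite big_ord0; exact: smooth_cexpr_cst.
by under eq_fun do rewrite big_ord_recr/=; apply: smooth_cexpr_add => //; exact: IH.
Qed.

Lemma smooth_cexpr_toC : smooth_cexpr toC.
Proof. by split; [exact: se_fst|exact: se_snd]. Qed.

Lemma smooth_cexpr_homogeneous d (g : C * C -> C) h k : homogeneous d g ->
  smooth_cexpr h -> smooth_cexpr k -> smooth_cexpr (fun p => g (h p, k p)).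
Proof.
move=> [a ga] sh sk; under eq_fun do rewrite ga/=.
apply: smooth_cexpr_sum => i; apply: smooth_cexpr_mul; last exact: smooth_cexpr_exp.
by apply: smooth_cexpr_mul; [exact: smooth_cexpr_cst|exact: smooth_cexpr_exp].
Qed.

Lemma smooth_expr_sqr_enorm h k : smooth_cexpr h -> smooth_cexpr k ->
  smooth_expr (fun p => enorm (h p, k p) ^+ 2).
Proof.
have sq f : smooth_expr f -> smooth_expr (fun p => f p ^+ 2).
  by move=> sf; under eq_fun do rewrite expr2; exact: se_mul.
move=> [h1 h2] [k1 k2].
rewrite (_ : (fun _ => _) = fun p => (complex.Re (h p) ^+ 2 + complex.Im (h p) ^+ 2) +
  (complex.Re (k p) ^+ 2 + complex.Im (k p) ^+ 2)).
  by do 2!apply: se_add; exact: sq.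
apply/funext => p; rewrite /enorm/= sqr_sqrtr ?addr_ge0 ?sqr_ge0//.
by case: (h p) (k p) => [? ?] [? ?]; rewrite /normc !sqr_sqrtr// addr_ge0// sqr_ge0.
Qed.

Lemma measurable_smooth_expr (f : R * R -> R) : smooth_expr f -> measurable_fun setT f.
Proof.
elim=> {f} [c|||f g sf mf sg mg|f g sf mf sg mg|f sf mf f0|f sf mf f0].
- exact: measurable_cst.
- exact: measurable_fst.
- exact: measurable_snd.
- exact: measurable_funD.
- exact: measurable_funM.
- exact: (measurableT_comp (measurable_invr R) mf).
- by apply: (measurableT_comp _ mf); exact: measurable_ln.
Qed.

End complex_expr.

Section enorm.
Context {R : realType}.
Local Notation C := (R[i]%C).
Implicit Types (v : C * C) (c : C).

Lemma normc_ge0 c : 0 <= normc c. Proof. by case: c => a b; exact: sqrtr_ge0. Qed.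

Lemma normc_gt0 c : (0 < normc c) = (c != 0).
Proof.
rewrite lt_neqAle normc_ge0 andbT; congr (~~ _); apply/eqP/eqP => [|->]; last by rewrite normc0.
by move/esym; exact: eq0_normc.
Qed.

Lemma normcX c n : normc (c ^+ n) = normc c ^+ n.
Proof. by elim: n => [|n IH]; rewrite ?normc1// !exprS normcM IH. Qed.

Lemma enorm_ge0 v : 0 <= enorm v. Proof. exact: sqrtr_ge0. Qed.

Lemma sqr_enorm v : enorm v ^+ 2 = normc v.1 ^+ 2 + normc v.2 ^+ 2.
Proof. by rewrite sqr_sqrtr// addr_ge0// sqr_ge0. Qed.

Lemma enorm_gt0 v : (0 < enorm v) = (v != (0, 0)).
Proof.
rewrite sqrtr_gt0 lt_neqAle addr_ge0 ?sqr_ge0// andbT eq_sym paddr_eq0 ?sqr_ge0// !sqrf_eq0.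
case: v => a b; rewrite xpair_eqE/= -[normc a == 0]negbK -[normc b == 0]negbK.
have E c : (normc c != 0) = (c != 0) by rewrite -normc_gt0 lt_neqAle normc_ge0 andbT eq_sym.
by rewrite !E !negbK.
Qed.

Lemma enormZ c v : enorm (c * v.1, c * v.2) = normc c * enorm v.
Proof.
rewrite /enorm/= !normcM !exprMn -mulrDr sqrtrM ?sqr_ge0// sqrtr_sqr.
by rewrite ger0_norm// normc_ge0.
Qed.

Lemma normc_le_enorm1 v : normc v.1 <= enorm v.
Proof. by rewrite -ler_sqr ?nnegrE ?normc_ge0 ?enorm_ge0// sqr_enorm lerDl sqr_ge0. Qed.

Lemma normc_le_enorm2 v : normc v.2 <= enorm v.
Proof. by rewrite -ler_sqr ?nnegrE ?normc_ge0 ?enorm_ge0// sqr_enorm lerDr sqr_ge0. Qed.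

Lemma enorm_le v : enorm v <= normc v.1 + normc v.2.
Proof.
rewrite -ler_sqr ?nnegrE ?addr_ge0 ?normc_ge0 ?enorm_ge0// sqr_enorm sqrrD.
by rewrite lerD2r lerDl mulrn_wge0 ?mulr_ge0 ?normc_ge0.
Qed.

End enorm.

Lemma homogeneousZ (R : realType) d (g : R[i]%C * R[i]%C -> R[i]%C) (c : R[i]%C) v :
  homogeneous d g -> g (c * v.1, c * v.2) = c ^+ d * g v.
Proof.
move=> [a ga]; rewrite !ga mulr_sumr; apply: eq_bigr => i _ /=.
have -> : c ^+ d = c ^+ (d - i) * c ^+ i by rewrite -exprD subnK// -ltnS.
by rewrite !exprMn; ring.
Qed.

(** * Convergence, homogeneity and continuity of the Green function *)

Section green_function.
Context {R : realType}.
Local Notation C := (R[i]%C).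
Context (d : nat) (F : C * C -> C * C).
Context (d1 : (1 < d)%N) (hF1 : homogeneous d (fun v => (F v).1))
  (hF2 : homogeneous d (fun v => (F v).2)) (F0 : forall v, F v = (0, 0) <-> v = (0, 0)).
Implicit Types (v : C * C) (c : C) (h l : R * R -> C).

Lemma lift_eq0 v : (F v == (0, 0)) = (v == (0, 0)).
Proof. by apply/eqP/eqP => /F0. Qed.

Lemma iter_lift_eq0 k v : (iter k F v == (0, 0)) = (v == (0, 0)).
Proof. by elim: k => //= k IH; rewrite lift_eq0. Qed.

Lemma liftZ c v : F (c * v.1, c * v.2) = (c ^+ d * (F v).1, c ^+ d * (F v).2).
Proof.
by rewrite [LHS]surjective_pairing (homogeneousZ _ _ _ _ _ hF1) (homogeneousZ _ _ _ _ _ hF2).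
Qed.

Lemma iter_liftZ k c v : iter k F (c * v.1, c * v.2) =
  (c ^+ (d ^ k) * (iter k F v).1, c ^+ (d ^ k) * (iter k F v).2).
Proof.
elim: k => [|k IH]; first by rewrite expn0 expr1.
by rewrite iterS IH liftZ -exprM -expnSr.
Qed.

Lemma smooth_cexpr_lift h l : smooth_cexpr h -> smooth_cexpr l ->
  smooth_cexpr (fun p => (F (h p, l p)).1) /\ smooth_cexpr (fun p => (F (h p, l p)).2).
Proof.
by move=> sh sk; split; [exact: (smooth_cexpr_homogeneous _ _ _ _ hF1)
                        |exact: (smooth_cexpr_homogeneous _ _ _ _ hF2)].
Qed.

Lemma smooth_cexpr_iter_lift n h l : smooth_cexpr h -> smooth_cexpr l ->
  smooth_cexpr (fun p => (iter n F (h p, l p)).1) /\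
  smooth_cexpr (fun p => (iter n F (h p, l p)).2).
Proof.
move=> sh sk; elim: n => [//|n [IH1 IH2]].
have := smooth_cexpr_lift _ _ IH1 IH2.
have E p : iter n.+1 F (h p, l p) = F ((iter n F (h p, l p)).1, (iter n F (h p, l p)).2).
  by rewrite -surjective_pairing.
by move=> [H1 H2]; split; under eq_fun do rewrite E.
Qed.

(** Extreme values on the compact square; the minimum is positive because [F] vanishes only at the
    origin. The square contains the unit disc, which is all that each affine chart needs. *)
Lemma lift_bound_square h l : smooth_cexpr h -> smooth_cexpr l ->
  (forall p, (h p, l p) != (0, 0)) ->
  exists m M : R, [/\ 0 < m, 0 < M & forall p, `|p.1| <= 1 -> `|p.2| <= 1 ->
    m <= enorm (F (h p, l p)) <= M].
Proof.
move=> sh sk nz; have [s1 s2] := smooth_cexpr_lift _ _ sh sk.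
pose A : set (R * R) := `[-1, 1]%classic `*` `[-1, 1]%classic.
have cA : compact A by apply: compact_setX; exact: segment_compact.
have A0 : A !=set0 by exists (0, 0); split; rewrite /= in_itv/=; lra.
pose g p := enorm (F (h p, l p)).
have cg : {within A, continuous g}.
  apply: continuous_subspaceT => p.
  rewrite (_ : g = fun p => Num.sqrt (enorm ((F (h p, l p)).1, (F (h p, l p)).2) ^+ 2)).
    apply: continuous_cvg; first exact: sqrt_continuous.
    by apply: smooth_expr_continuous; exact: smooth_expr_sqr_enorm.
  by apply/funext => q; rewrite -surjective_pairing sqrtr_sqr ger0_norm ?enorm_ge0.
have [a _ amin] := compact_EVT_min A0 cA cg.
have [b _ bmax] := compact_EVT_max A0 cA cg.
exists (g a), (g b); split.
- by rewrite enorm_gt0 lift_eq0.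
- by rewrite enorm_gt0 lift_eq0.
- move=> p p1 p2; have pA : p \in A.
    by rewrite inE; split; rewrite /= in_itv/= -ler_norml.
  by rewrite amin// bmax.
Qed.

(** Dividing by the coordinate of larger modulus writes [v = c w], where one coordinate of [w] is
    [1] and the other lies in the unit disc; homogeneity then removes [c]. Since [enorm w] lies
    between [1] and [2], the lower constant loses the factor [2 ^+ d]. *)
Lemma lift_bounds : exists m M : R, [/\ 0 < m, 0 < M & forall v, v != (0, 0) ->
  m * enorm v ^+ d <= enorm (F v) <= M * enorm v ^+ d].
Proof.
have [m1 [M1 [m10 M10 b1]]] : exists m M : R, [/\ 0 < m, 0 < M & forall p,
    `|p.1| <= 1 -> `|p.2| <= 1 -> m <= enorm (F (1, toC p)) <= M].
  apply: (lift_bound_square (fun=> 1)); first exact: smooth_cexpr_cst.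
    exact: smooth_cexpr_toC.
  by move=> p; rewrite xpair_eqE oner_eq0.
have [m2 [M2 [m20 M20 b2]]] : exists m M : R, [/\ 0 < m, 0 < M & forall p,
    `|p.1| <= 1 -> `|p.2| <= 1 -> m <= enorm (F (toC p, 1)) <= M].
  apply: (lift_bound_square _ (fun=> 1)); first exact: smooth_cexpr_toC.
    exact: smooth_cexpr_cst.
  by move=> p; rewrite xpair_eqE oner_eq0 andbF.
pose m := Num.min m1 m2; pose M := Num.max M1 M2.
have m00 : 0 < m by rewrite lt_min m10.
have M00 : 0 < M by rewrite lt_max M10.
have part c w : c != 0 -> 1 <= enorm w <= 2 -> m <= enorm (F w) <= M ->
    m / 2 ^+ d * enorm (c * w.1, c * w.2) ^+ d <= enorm (F (c * w.1, c * w.2)) <=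
    M * enorm (c * w.1, c * w.2) ^+ d.
  move=> c0 /andP[w1 w2] /andP[Fm FM]; rewrite liftZ !enormZ !exprMn normcX.
  have cd : 0 < normc c ^+ d by rewrite exprn_gt0// normc_gt0.
  have e1 : 1 <= enorm w ^+ d by rewrite exprn_ege1.
  have e2 : enorm w ^+ d <= 2 ^+ d by rewrite lerXn2r ?nnegrE ?enorm_ge0.
  have t0 : 0 < 2 ^+ d :> R by rewrite exprn_gt0.
  rewrite ![_ * (normc c ^+ d * _)]mulrCA !ler_pM2l//; apply/andP; split.
    by rewrite (le_trans _ Fm)// mulrAC ler_pdivrMr// ler_pM2l.
  by rewrite (le_trans FM)// ler_peMr// ltW.
have square (w : C) : normc w <= 1 -> `|(ofC w).1| <= 1 /\ `|(ofC w).2| <= 1.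
  case: w => x y xy /=; have nn := sqrtr_ge0 (x ^+ 2 + y ^+ 2).
  have xy1 : x ^+ 2 + y ^+ 2 <= 1.
    by rewrite -[leLHS]sqr_sqrtr ?addr_ge0 ?sqr_ge0// exprn_ile1.
  have := sqr_ge0 x; have := sqr_ge0 y => y2 x2.
  by split; rewrite -(ler_pXn2r (ltn0Sn 1)) ?nnegrE// expr1n real_normK ?num_real//; lra.
exists (m / 2 ^+ d), M; split => //.
- by rewrite divr_gt0// exprn_gt0.
- move=> [a b] v0; have [ba|ab] := lerP (normc b) (normc a).
    have a0 : a != 0.
      apply: contra v0 => /eqP a0; move: ba; rewrite a0 normc0 => b0.
      have /eqP -> : b == 0 by rewrite -[_ == _]negbK -normc_gt0 -leNgt.
      by rewrite eqxx.
    have an : 0 < normc a by rewrite normc_gt0.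
    have nw : normc (b / a) <= 1 by rewrite normcM normcV ler_pdivrMr// mul1r.
    have := part a (1, b / a) a0; rewrite /= mulr1 (_ : a * (b / a) = b) ?(mulrC a) ?divfK//; apply.
      apply/andP; split; first by rewrite -(@normc1 R); exact: (normc_le_enorm1 (1, b / a)).
      apply: (le_trans (enorm_le _)).
      by change (normc (1 : C) + normc (b / a) <= 2); rewrite normc1; lra.
    have [s1 s2] := square _ nw.
    have := b1 _ s1 s2; rewrite ofCK => /andP[h1 h2].
    by rewrite ge_min h1 le_max h2.
  have b0 : b != 0 by rewrite -normc_gt0 (le_lt_trans (normc_ge0 a)).
  have bn : 0 < normc b by rewrite normc_gt0.
  have nw : normc (a / b) <= 1 by rewrite normcM normcV ler_pdivrMr// mul1r ltW.
  have := part b (a / b, 1) b0; rewrite /= mulr1 (_ : b * (a / b) = a) ?(mulrC b) ?divfK//; apply.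
    apply/andP; split; first by rewrite -(@normc1 R); exact: (normc_le_enorm2 (a / b, 1)).
    apply: (le_trans (enorm_le _)).
    by change (normc (a / b) + normc (1 : C) <= 2); rewrite normc1; lra.
  have [s1 s2] := square _ nw.
  have := b2 _ s1 s2; rewrite ofCK => /andP[h1 h2].
  by rewrite ge_min h1 orbT le_max h2 orbT.
Qed.

Lemma lift_ln_bound : exists2 K : R, 0 <= K & forall v, v != (0, 0) ->
  `|ln (enorm (F v)) - d%:R * ln (enorm v)| <= K.
Proof.
have [m [M [m0 M0 b]]] := lift_bounds.
exists (`|ln m| + `|ln M|); first by rewrite addr_ge0.
move=> v v0; have /andP[h1 h2] := b v v0.
have e0 : 0 < enorm v by rewrite enorm_gt0.
have ed0 : 0 < enorm v ^+ d by rewrite exprn_gt0.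
have Fe0 : 0 < enorm (F v) by rewrite enorm_gt0 lift_eq0.
have l1 : ln m + d%:R * ln (enorm v) <= ln (enorm (F v)).
  by rewrite mulr_natl -lnXn// -lnM// ler_ln ?posrE// mulr_gt0.
have l2 : ln (enorm (F v)) <= ln M + d%:R * ln (enorm v).
  by rewrite mulr_natl -lnXn// -lnM// ler_ln ?posrE// mulr_gt0.
have := ler_norm (- ln m); have := ler_norm (ln M); rewrite normrN.
have := normr_ge0 (ln m); have := normr_ge0 (ln M).
by rewrite ler_norml => *; apply/andP; split; lra.
Qed.

Definition log_iter v k : R := d%:R ^- k * ln (enorm (iter k F v)).

(** Real-valued counterpart of [green], equal to it off the origin by [greenE]. At the origin they
    differ, since [ln 0 = 0] whereas [lne 0 = -oo]. *)
Definition greenR v : R := limn (log_iter v).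

Lemma degree_gt0 : 0 < d%:R :> R. Proof. by rewrite ltr0n ltnW. Qed.

Lemma degree_ge2 : 2 <= d%:R :> R. Proof. by rewrite ler_nat. Qed.

(** The natural bound is [K / d^(k+1)]. It is weakened to a difference of consecutive powers,
    legitimate because [d - 1 >= 1], so that summation over [k] telescopes. *)
Lemma log_iter_step : exists2 K : R, 0 <= K & forall v, v != (0, 0) -> forall k,
  `|log_iter v k.+1 - log_iter v k| <= K * (d%:R ^- k - d%:R ^- k.+1).
Proof.
have [K K0 b] := lift_ln_bound; exists K => // v v0 k.
have d0 := degree_gt0; have d2 := degree_ge2.
have dk : 0 < d%:R ^- k.+1 :> R by rewrite invr_gt0 exprn_gt0.
have E : d%:R ^- k = d%:R * d%:R ^- k.+1 :> R.
  by rewrite exprS invfM mulrA divff ?mul1r// gt_eqF.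
rewrite /log_iter [in leLHS]E -mulrA mulrCA -mulrBr normrM gtr0_norm//.
have nz : iter k F v != (0, 0) by rewrite iter_lift_eq0.
have := ler_wpM2l (ltW dk) (b _ nz); rewrite /= => /le_trans; apply.
rewrite mulrC ler_wpM2l// E; nra.
Qed.

Lemma log_iter_dist : exists2 K : R, 0 <= K & forall v, v != (0, 0) -> forall k n,
  `|log_iter v (k + n) - log_iter v k| <= K * (d%:R ^- k - d%:R ^- (k + n)).
Proof.
have [K K0 b] := log_iter_step; exists K => // v v0 k.
elim=> [|n IH]; first by rewrite addn0 !subrr normr0 mulr0.
have h := b v v0 (k + n)%N; rewrite addnS.
have -> : log_iter v (k + n).+1 - log_iter v k =
  (log_iter v (k + n).+1 - log_iter v (k + n)) + (log_iter v (k + n) - log_iter v k) by ring.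
rewrite (le_trans (ler_normD _ _))// (le_trans (lerD h IH))// -mulrDr.
by rewrite le_eqVlt; apply/orP; left; apply/eqP; congr (_ * _); ring.
Qed.

Lemma cvg_inv_degree_exp : d%:R ^- k @[k --> \oo] --> (0 : R).
Proof.
under eq_fun do rewrite -exprVn.
apply: cvg_expr; rewrite ger0_norm ?invr_ge0 ?ltW ?degree_gt0//.
by rewrite invf_lt1 ?degree_gt0// (lt_le_trans _ degree_ge2)// ltr1n.
Qed.

Lemma small_degree_exp (K e : R) : 0 < e -> exists k, K * d%:R ^- k < e.
Proof.
move=> e0.
have : K * d%:R ^- k @[k --> \oo] --> K * 0 by apply: cvgMl_tmp; exact: cvg_inv_degree_exp.
rewrite mulr0 => /cvgr_lt /(_ _ e0) [k _ h]; exists k; exact: (h k (leqnn k)).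
Qed.

Lemma cvg_log_iter v : v != (0, 0) -> log_iter v k @[k --> \oo] --> greenR v.
Proof.
move=> v0; have [K K0 b] := log_iter_dist.
suff : cvgn (log_iter v) by [].
apply/cauchy_cvgP; apply: cauchy_exP => e e0.
have [k ke] := small_degree_exp K e e0.
exists (log_iter v k).
suff : \forall n \near \oo, ball (log_iter v k) e (log_iter v n) by [].
near=> n; have kn : (k <= n)%N by near: n; exact: nbhs_infty_ge.
have := b v v0 k (n - k)%N; rewrite subnKC// distrC => h.
apply: (le_lt_trans h); apply: (le_lt_trans _ ke); rewrite ler_wpM2l// gerBl.
by rewrite invr_ge0 exprn_ge0// ltW ?degree_gt0.
Unshelve. all: by end_near. Qed.

Lemma greenR_dist : exists2 K : R, 0 <= K & forall v, v != (0, 0) -> forall k,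
  `|greenR v - log_iter v k| <= K * d%:R ^- k.
Proof.
have [K K0 b] := log_iter_dist; exists K => // v v0 k.
have c := cvg_log_iter _ v0.
have cn : `|log_iter v n - log_iter v k| @[n --> \oo] --> `|greenR v - log_iter v k|.
  by apply: cvg_norm; apply: cvgB => //; exact: cvg_cst.
rewrite -(cvg_lim _ cn)//; apply: limr_le; first by apply/cvg_ex; eexists; exact: cn.
near=> n; have kn : (k <= n)%N by near: n; exact: nbhs_infty_ge.
have := b v v0 k (n - k)%N; rewrite subnKC// => /le_trans; apply.
by rewrite ler_wpM2l// gerBl invr_ge0 exprn_ge0// ltW ?degree_gt0.
Unshelve. all: by end_near. Qed.

(** The case [k = 0] of [greenR_dist]. This comparison with [ln (enorm v)] underlies every
    domination argument below. *)
Lemma greenR_enorm_dist : exists2 K : R, 0 <= K & forall v, v != (0, 0) ->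
  `|greenR v - ln (enorm v)| <= K.
Proof.
have [K K0 b] := greenR_dist; exists K => // v v0.
by have := b v v0 0; rewrite /log_iter/= expr0 invr1 mul1r mulr1.
Qed.

Lemma greenE v : v != (0, 0) -> green d F v = (greenR v)%:E.
Proof.
move=> v0; rewrite /green /greenR.
rewrite (_ : (fun k => _) = EFin \o log_iter v).
  by rewrite EFin_lim//; apply/cvg_ex; exists (greenR v); exact: cvg_log_iter.
apply/funext => k; rewrite lne_EFin ?EFinM//.
by rewrite enorm_gt0 iter_lift_eq0.
Qed.

Lemma greenR_lift v : v != (0, 0) -> greenR (F v) = d%:R * greenR v.
Proof.
move=> v0; have Fv0 : F v != (0, 0) by rewrite lift_eq0.
rewrite {1}/greenR; apply: cvg_lim => //.
rewrite (_ : log_iter (F v) = fun k => d%:R * log_iter v k.+1).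
  apply: cvgMl_tmp; rewrite (cvg_shiftS (log_iter v)); exact: cvg_log_iter.
apply/funext => k; rewrite /log_iter -iterSr mulrA; congr (_ * _).
by rewrite exprS invfM mulrA divff ?mul1r// gt_eqF ?degree_gt0.
Qed.

(** The [k]-th iterate is homogeneous of degree [d ^ k], so each term of the sequence already shifts
    by exactly [ln (normc c)]. *)
Lemma greenRZ c v : c != 0 -> v != (0, 0) ->
  greenR (c * v.1, c * v.2) = ln (normc c) + greenR v.
Proof.
move=> c0 v0.
rewrite {1}/greenR; apply: cvg_lim => //.
rewrite (_ : log_iter _ = fun k => ln (normc c) + log_iter v k).
  by apply: cvgD; [exact: cvg_cst|exact: cvg_log_iter].
apply/funext => k; rewrite /log_iter iter_liftZ enormZ normcX.
have n0 : 0 < normc c by rewrite normc_gt0.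
rewrite lnM ?posrE ?exprn_gt0// ?enorm_gt0 ?iter_lift_eq0// lnXn// mulrDr -[ln _ *+ _]mulr_natl natrX.
by rewrite mulrA mulVf ?mul1r// expf_neq0// gt_eqF ?degree_gt0.
Qed.

(** Stated along a parametrisation [(h, l)] of nonzero vectors by the real plane, which covers the
    affine chart as well as the rescaled families used near infinity. Passing to the squared norm
    avoids square roots. *)
Lemma smooth_expr_log_iter h l k : smooth_cexpr h -> smooth_cexpr l ->
  (forall p, (h p, l p) != (0, 0)) -> smooth_expr (fun p => log_iter (h p, l p) k).
Proof.
move=> sh sl nz; have [s1 s2] := smooth_cexpr_iter_lift k _ _ sh sl.
rewrite (_ : (fun _ => _) = fun p => (d%:R ^- k / 2) *
   ln (enorm ((iter k F (h p, l p)).1, (iter k F (h p, l p)).2) ^+ 2)).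
  apply: se_mul; first exact: se_cst.
  apply: se_ln; first exact: smooth_expr_sqr_enorm.
  by move=> p; rewrite -surjective_pairing exprn_gt0// enorm_gt0 iter_lift_eq0.
apply/funext => p; rewrite -surjective_pairing lnXn ?enorm_gt0 ?iter_lift_eq0//.
by rewrite /log_iter -[ln _ *+ _]mulr_natl mulrA divfK.
Qed.

Lemma measurable_greenR h l : smooth_cexpr h -> smooth_cexpr l ->
  (forall p, (h p, l p) != (0, 0)) -> measurable_fun setT (fun p => greenR (h p, l p)).
Proof.
move=> sh sl nz.
apply: (@measurable_fun_cvg _ _ _ _ (fun k p => log_iter (h p, l p) k)).
  by move=> k; apply: measurable_smooth_expr; exact: smooth_expr_log_iter.
by move=> p _; exact: cvg_log_iter.
Qed.

(** Uniform limit of continuous functions: the bound of [greenR_dist] does not depend on the vector,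
    and [e] is split into three. *)
Lemma continuous_greenR h l : smooth_cexpr h -> smooth_cexpr l ->
  (forall p, (h p, l p) != (0, 0)) -> continuous (fun p => greenR (h p, l p)).
Proof.
move=> sh sl nz p; have [K K0 b] := greenR_dist.
apply/cvgrPdist_lt => e e0.
have e3 : 0 < e / 3 by rewrite divr_gt0.
have [k ke] := small_degree_exp K _ e3.
have ck := smooth_expr_continuous _ (smooth_expr_log_iter _ _ k sh sl nz) p.
move/cvgrPdist_lt : ck => /(_ _ e3); apply: filterS => q hq.
have h1 := b _ (nz p) k; have h2 := b _ (nz q) k.
have -> : greenR (h p, l p) - greenR (h q, l q) = (greenR (h p, l p) - log_iter (h p, l p) k) +
  (log_iter (h p, l p) k - log_iter (h q, l q) k) - (greenR (h q, l q) - log_iter (h q, l q) k).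
  by ring.
rewrite (le_lt_trans (ler_normB _ _))//.
have := ler_normD (greenR (h p, l p) - log_iter (h p, l p) k)
  (log_iter (h p, l p) k - log_iter (h q, l q) k).
lra.
Qed.

End green_function.

(** * Regularisations of the Green function *)

Section affine_integrable.
Context {R : realType}.
Local Notation leb := (@lebesgue_measure R).
Local Notation leb2 := (leb \x leb)%E.

Definition affine (z : R * R) (s : R) (p : R * R) : R * R := (z.1 + s * p.1, z.2 + s * p.2).

Lemma measurable_affine2 z s : measurable_fun setT (affine z s).
Proof.
by apply: measurable_fun_pair; apply: measurable_funD => //; apply: measurable_funM.
Qed.

Lemma integrable2_affine (z : R * R) (s : R) (f : R * R -> \bar R) : 0 < s ->
  measurable_fun setT f -> leb2.-integrable setT (f \o affine z s) ->
  leb2.-integrable setT f.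
Proof.
move=> s0 mf /integrableP[_ fi]; apply/integrableP; split => //.
rewrite (@ge0_integral2_affine _ z.1 z.2 s)//; last by apply: measurableT_comp.
by apply: lte_mul_pinfty => //; rewrite lee_fin sqr_ge0.
Qed.

Lemma integral2_affine (z : R * R) (s : R) (f : R * R -> \bar R) : 0 < s ->
  measurable_fun setT f -> leb2.-integrable setT (f \o affine z s) ->
  (\int[leb2]_p f p = (s ^+ 2)%:E * \int[leb2]_p f (affine z s p))%E.
Proof.
move=> s0 mf fi; rewrite integralE.
rewrite (@ge0_integral2_affine _ z.1 z.2 s (f^\+)%E)//; last exact: measurable_funepos.
rewrite (@ge0_integral2_affine _ z.1 z.2 s (f^\-)%E)//; last exact: measurable_funeneg.
have i1 := integrable_pos_fin_num measurableT fi.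
have i2 := integrable_neg_fin_num measurableT fi.
transitivity ((s ^+ 2)%:E * (\int[leb2]_p (f \o affine z s)^\+ p -
    \int[leb2]_p (f \o affine z s)^\- p))%E; last by rewrite -integralE.
rewrite [RHS]muleBr; [|by []|exact: fin_num_adde_defr].
congr (_ * _ - _ * _)%E; apply: eq_integral => p _.
  by rewrite [in RHS]funepos_comp.
by rewrite [in RHS]funeneg_comp.
Qed.

(** One dominating function for every limit of averages: [1] absorbs constants, [norm2 p] the growth
    at infinity, and its inverse the logarithmic pole at the origin. *)
Definition majorant (p : R * R) : R := (1 + (norm2 p + (norm2 p)^-1)) * kernel p.

Lemma majorant_ge0 p : 0 <= majorant p.
Proof.
rewrite mulr_ge0 ?kernel_ge0// addr_ge0// addr_ge0 ?norm2_ge0// invr_ge0 norm2_ge0//.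
Qed.

Lemma integrable_kernel : leb2.-integrable setT (fun p => (kernel p)%:E).
Proof.
apply/integrableP; split; first by apply/measurable_EFinP; exact: measurable_kernel.
rewrite (_ : (\int[leb2]_p _ = \int[leb2]_p (kernel p)%:E)%E).
  by rewrite integral_kernel ltry.
by apply: eq_integral => p _; rewrite gee0_abs// lee_fin kernel_ge0.
Qed.

Lemma integrable_majorant (c : R) : leb2.-integrable setT (fun p => (c * majorant p)%:E).
Proof.
rewrite (_ : (fun p => _) = fun p => (c%:E * ((kernel p)%:E +
    ((norm2 p + (norm2 p)^-1) * kernel p)%:E))%E).
  apply: integrableZl => //; apply: integrableD => //; first exact: integrable_kernel.
  exact: integrable_inv_norm2_kernel.
by apply/funext => p; rewrite -EFinD -EFinM /majorant mulrDl mul1r.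
Qed.

Let set1X (p : R * R) : [set p] = [set p.1] `*` [set p.2].
Proof.
by apply/seteqP; split => [q ->//|[a b] [/= -> ->]]; rewrite -surjective_pairing.
Qed.

Lemma measurable2_set1 (p : R * R) : measurable [set p].
Proof. by rewrite set1X; exact: measurableX. Qed.

Lemma lebesgue2_set1 (p : R * R) : (leb2 [set p] = 0)%E.
Proof. by rewrite set1X product_measure1E//= lebesgue_measure_set1 mul0e. Qed.

Lemma integrable_majorized (c : R) (f : R * R -> R) : measurable_fun setT f ->
  (forall p, `|f p| <= c * majorant p) -> leb2.-integrable setT (fun p => (f p)%:E).
Proof.
move=> mf fc; apply: (le_integrable measurableT _ _ (integrable_majorant c)).
  exact/measurable_EFinP.
by move=> p _; rewrite /= lee_fin (le_trans (fc p))// ler_norm.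
Qed.

End affine_integrable.

(** * Averages of the Green function at small and at large scale *)

Section regularised_green.
Context {R : realType}.
Local Notation C := (R[i]%C).
Local Notation leb := (@lebesgue_measure R).
Local Notation leb2 := (leb \x leb)%E.
Context (d : nat) (F : C * C -> C * C).
Context (d1 : (1 < d)%N) (hF1 : homogeneous d (fun v => (F v).1))
  (hF2 : homogeneous d (fun v => (F v).2)) (F0 : forall v, F v = (0, 0) <-> v = (0, 0)).
Context (z0 : C).
Local Notation G := (greenR d F).
Local Notation z := (ofC z0).

Lemma normc_toC p : normc (toC p) = norm2 p :> R. Proof. by []. Qed.

Definition smoothed (e : R) : \bar R := (\int[leb2]_p (G (1, toC (affine z e p)) * kernel p)%:E)%E.

(** The average at scale [1 / t], with the factor [t] moved inside the vector. In this form it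
    converges as [t] tends to [0], the vectors tending to [(0, toC p)]. *)
Definition smoothed_infty (t : R) : \bar R :=
  (\int[leb2]_p (G ((t +i* 0)%C, (t +i* 0)%C * z0 + toC p) * kernel p)%:E)%E.

Lemma oneC_neq0 (w : C) : (1 : C, w) != (0, 0).
Proof. by rewrite xpair_eqE oner_eq0. Qed.

Lemma toC_affine e p : toC (affine z e p) = z0 + (e +i* 0)%C * toC p.
Proof. by case: z0 p => a b [x y]; rewrite /toC /affine/=; congr (_ +i* _)%C; ring. Qed.

Let measurable_G : measurable_fun setT (fun p => G (1, toC p)).
Proof.
apply: (measurable_greenR d F d1 hF1 hF2 F0 (fun=> 1) toC); first exact: smooth_cexpr_cst.
  exact: smooth_cexpr_toC.
by move=> p; exact: oneC_neq0.
Qed.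

Let measurable_G_affine e : measurable_fun setT (fun p => G (1, toC (affine z e p)) * kernel p).
Proof.
apply: measurable_funM; last exact: measurable_kernel.
exact: (measurableT_comp measurable_G (measurable_affine2 z e)).
Qed.

Let tC_neq0 (t : R) : 0 < t -> (t +i* 0)%C != 0.
Proof. by move=> t0; rewrite eq_complex/= gt_eqF. Qed.

Let measurable_G_infty t : 0 < t ->
  measurable_fun setT (fun p => G ((t +i* 0)%C, (t +i* 0)%C * z0 + toC p) * kernel p).
Proof.
move=> t0; apply: measurable_funM; last exact: measurable_kernel.
apply: (measurable_greenR d F d1 hF1 hF2 F0 (fun=> (t +i* 0)%C)
  (fun p => (t +i* 0)%C * z0 + toC p)); first exact: smooth_cexpr_cst.
  by apply: smooth_cexpr_add; [exact: smooth_cexpr_cst|exact: smooth_cexpr_toC].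
by move=> p; rewrite xpair_eqE negb_and tC_neq0.
Qed.

Let le_majorant (a b c x : R) p : `|x| <= a + b * norm2 p + c * (norm2 p)^-1 ->
  0 <= a -> 0 <= b -> 0 <= c -> `|x * kernel p| <= (a + b + c) * majorant p.
Proof.
move=> xle a0 b0 c0; have k0 := kernel_ge0 p; have n0 := norm2_ge0 p.
have i0 : 0 <= (norm2 p)^-1 by rewrite invr_ge0.
rewrite normrM (ger0_norm k0) /majorant mulrA ler_wpM2r//.
apply: (le_trans xle); nra.
Qed.

(** The first coordinate being [1], the norm is at least [1], so its logarithm lies between [0] and
    the norm, which is at most affine in [norm2 p]. *)
Let G_bound : exists2 c : R, 0 <= c & forall e p, 0 <= e ->
  `|G (1, toC (affine z e p)) * kernel p| <= (c + e) * majorant p.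
Proof.
have [K K0 GK] := greenR_enorm_dist d F d1 hF1 hF2 F0.
exists (K + (1 + normc z0)); first by rewrite !addr_ge0// normc_ge0.
move=> e p e0; rewrite -[_ + e]addr0; apply: le_majorant => //; last first.
  by rewrite !addr_ge0// normc_ge0.
have := GK _ (oneC_neq0 (toC (affine z e p))); set v := (_, _).
have v0 : v != (0, 0) by exact: oneC_neq0.
have l0 : 0 <= ln (enorm v).
  by apply: ln_ge0; rewrite -(@normc1 R); exact: (normc_le_enorm1 v).
have l1 : ln (enorm v) <= 1 + normc z0 + e * norm2 p.
  apply: (le_trans (ltW (ln_sublinear _))); first by rewrite enorm_gt0.
  apply: (le_trans (enorm_le v)).
  change (normc (1 : C) + normc (toC (affine z e p)) <= 1 + normc z0 + e * norm2 p).
  rewrite normc1 -addrA lerD2l toC_affine (le_trans (le_normcD _ _))// lerD2l normcM normc_toC.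
  by rewrite /= expr0n addr0 sqrtr_sqr ger0_norm.
rewrite !ler_norml => /andP[h1 h2]; rewrite mul0r addr0; apply/andP; split; lra.
Qed.

Let G_infty_bound : exists2 c : R, 0 <= c & forall t p, 0 < t <= 1 -> p != (0, 0) ->
  `|G ((t +i* 0)%C, (t +i* 0)%C * z0 + toC p) * kernel p| <= c * majorant p.
Proof.
have [K K0 GK] := greenR_enorm_dist d F d1 hF1 hF2 F0.
have n0 := normc_ge0 z0.
exists ((K + (1 + normc z0)) + 1 + (1 + normc z0)); first by rewrite !addr_ge0.
move=> t p /andP[t0 t1] p0; apply: le_majorant => //; rewrite ?addr_ge0//.
have v0 : ((t +i* 0)%C, (t +i* 0)%C * z0 + toC p) != (0, 0).
  by rewrite xpair_eqE negb_and tC_neq0.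
have nt : normc (t +i* 0)%C = t by rewrite /= expr0n addr0 sqrtr_sqr gtr0_norm.
have np : 0 < norm2 p.
  by rewrite -normc_toC normc_gt0; case: p p0 {v0} => x y; rewrite eq_complex xpair_eqE.
have := GK _ v0; set v := (_, _) in v0 *.
have e0 : 0 < enorm v by rewrite enorm_gt0.
have u1 : enorm v <= 1 + normc z0 + norm2 p.
  apply: (le_trans (enorm_le v)).
  change (normc (t +i* 0)%C + normc ((t +i* 0)%C * z0 + toC p) <= 1 + normc z0 + norm2 p).
  rewrite nt -addrA lerD// (le_trans (le_normcD _ _))// lerD2r normcM nt ler_piMl//.
(* The delicate side, since the vector may come close to [0]. As [toC p = v.2 - t z0] and [t] is the
   modulus of [v.1], the norm of [v] is at least a fixed multiple of [norm2 p], uniformly in [t]. *)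
have u2 : norm2 p <= (1 + normc z0) * enorm v.
  have E : toC p = v.2 + - ((t +i* 0)%C * z0) by rewrite /v/= addrAC subrr add0r.
  rewrite -normc_toC E (le_trans (le_normcD _ _))// normcN normcM nt mulrDl mul1r.
  rewrite lerD ?normc_le_enorm2// mulrC ler_wpM2l//.
  by rewrite -[leLHS]nt; exact: (normc_le_enorm1 v).
have l1 := ltW (ln_sublinear e0).
have l2 : - ln (enorm v) <= (1 + normc z0) * (norm2 p)^-1.
  rewrite -lnV ?posrE//; apply: (le_trans (ltW (ln_sublinear _))); first by rewrite invr_gt0.
  by rewrite ler_pdivlMr// mulrC ler_pdivrMr.
have i0 : 0 <= (1 + normc z0) * (norm2 p)^-1 by rewrite mulr_ge0 ?invr_ge0 ?addr_ge0// ltW.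
rewrite !ler_norml => /andP[h1 h2]; apply/andP; split; lra.
Qed.

Lemma integrable_smoothed e : 0 <= e ->
  leb2.-integrable setT (fun p => (G (1, toC (affine z e p)) * kernel p)%:E).
Proof.
move=> e0; have [c c0 b] := G_bound.
by apply: integrable_majorized => // p; exact: b.
Qed.

Lemma cvg_smoothed : smoothed n.+1%:R^-1 @[n --> \oo] --> (G (1, z0))%:E.
Proof.
have [c c0 b] := G_bound.
rewrite (_ : (G (1, z0))%:E = \int[leb2]_p (G (1, z0) * kernel p)%:E)%E; last first.
  under eq_integral do rewrite EFinM.
  rewrite integralZl//; last exact: integrable_kernel.
  by rewrite integral_kernel mule1.
apply: (dominated_cvg measurableT _ _ _ (integrable_majorant (c + 1))).
- by move=> n; apply/measurable_EFinP; exact: measurable_G_affine.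
- move=> p _; apply: cvg_EFin; first by apply: nearW => n.
  rewrite /comp/=.
  apply: cvgMr_tmp.
  have cG : continuous (fun p => G (1, toC p)).
    apply: (continuous_greenR d F d1 hF1 hF2 F0 (fun=> 1) toC); first exact: smooth_cexpr_cst.
      exact: smooth_cexpr_toC.
    by move=> q; exact: oneC_neq0.
  rewrite -[X in G (1, X)](ofCK z0).
  apply: (continuous_cvg _ (cG z)).
  have h a x : a + n.+1%:R^-1 * x @[n --> \oo] --> (a : R).
    rewrite -[X in _ --> X]addr0 -[X in _ --> _ + X](mul0r x).
    by apply: cvgD; [exact: cvg_cst|apply: cvgMr_tmp; exact: cvg_harmonic].
  rewrite [z]surjective_pairing.
  have H := cvg_pair (h z.1 p.1) (h z.2 p.2).
  exact: H.
- by [].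
- move=> n p _; rewrite lee_fin (le_trans (b _ _ _))// ler_wpM2r ?majorant_ge0//.
  by rewrite lerD2l invf_le1// ler1n.
Qed.

Lemma integrable_ln_norm2_kernel :
  leb2.-integrable setT (fun p : R * R => (ln (norm2 p) * kernel p)%:E).
Proof.
apply: (integrable_majorized (0 + 1 + 1)).
  apply: measurable_funM; last exact: measurable_kernel.
  by apply: measurableT_comp; [exact: measurable_ln|exact: measurable_norm2].
move=> p; apply: le_majorant => //; rewrite !mul1r add0r.
have := norm2_ge0 p; rewrite le_eqVlt => /predU1P[<-|]; last exact: abs_ln_le.
by rewrite ln0// normr0 invr0 addr0.
Qed.

Lemma cvg_smoothed_infty : smoothed_infty n.+1%:R^-1 @[n --> \oo] --> (G (0, 1))%:E.
Proof.
have [c c0 b] := G_infty_bound.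
rewrite (_ : (G (0, 1))%:E =
    \int[leb2]_p ((ln (norm2 p) + G (0, 1)) * kernel p)%:E)%E; last first.
  under eq_integral do rewrite mulrDl EFinD [X in (_ + X)%E]EFinM.
  rewrite integralD//; last 2 first.
  - exact: integrable_ln_norm2_kernel.
  - by apply: integrableZl => //; exact: integrable_kernel.
  rewrite integralZl//; last exact: integrable_kernel.
  by rewrite integral_kernel mule1 -[LHS]add0e; congr (_ + _)%E; rewrite -integral_ln_norm2_kernel.
(* At [p = 0] the vector [(t, t z0)] tends to [0] with [t] and [G] tends to [-oo], so convergence
   and domination are claimed only almost everywhere. *)
have origin0 (P : R * R -> Prop) : (forall p, p != (0, 0) -> P p) -> {ae leb2, forall p, P p}.
  move=> hP; exists [set (0, 0)]; split; [exact: measurable2_set1|exact: lebesgue2_set1|].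
  by move=> p /= nP; apply: contrapT => /eqP p0; apply: nP; exact: hP.
have hn n : 0 < (n.+1%:R^-1 : R) <= 1 by rewrite invr_gt0 ltr0n invf_le1// ler1n.
pose fn n p := (G ((n.+1%:R^-1 +i* 0)%C, (n.+1%:R^-1 +i* 0)%C * z0 + toC p) * kernel p)%:E.
pose f p := ((ln (norm2 p) + G (0, 1)) * kernel p)%:E.
suff: [/\ forall n, measurable_fun setT (fn n), measurable_fun setT f,
    {ae leb2, forall p, setT p -> fn ^~ p @ \oo --> f p} &
    {ae leb2, forall p n, setT p -> (`|fn n p| <= (c * majorant p)%:E)%E}].
  move=> [H1 H2 H3 H4].
  by have [] := dominated_convergence (mu := leb2) measurableT H1 H2 H3 (integrable_majorant c) H4.
split.
- by move=> n; apply/measurable_EFinP; apply: measurable_G_infty; have /andP[] := hn n.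
- apply/measurable_EFinP; apply: measurable_funM; last exact: measurable_kernel.
  apply: measurable_funD => //.
  by apply: measurableT_comp; [exact: measurable_ln|exact: measurable_norm2].
- apply: origin0 => p p0 _; apply: cvg_EFin; first by apply: nearW.
  rewrite /comp/=; apply: cvgMr_tmp.
  have tp0 : toC p != 0 by case: p p0 => x y; rewrite eq_complex xpair_eqE.
  have -> : ln (norm2 p) + G (0, 1) = G (0, toC p).
    have := greenRZ d F d1 hF1 hF2 F0 (toC p) (0, 1) tp0; rewrite /= mulr0 mulr1 => -> //.
    by rewrite xpair_eqE oner_eq0 andbF.
  (* The scale [t] is made the first real coordinate of [q], so that continuity as [t] tends to [0]
     is an instance of [continuous_greenR]. At [q.1 = 0] the vector is nonzero because [toC p]
     is. *)
  pose h (q : R * R) : C := toC (q.1, 0).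
  pose l (q : R * R) : C := toC (q.1, 0) * z0 + toC p.
  have sh : smooth_cexpr h by split; [exact: se_fst|exact: se_cst].
  have sl : smooth_cexpr l.
    apply: smooth_cexpr_add; last exact: smooth_cexpr_cst.
    by apply: smooth_cexpr_mul => //; exact: smooth_cexpr_cst.
  have nz q : (h q, l q) != (0, 0).
    have [q0|q0] := eqVneq q.1 0; last by rewrite xpair_eqE /h eq_complex/= negb_and negb_and q0.
    by rewrite xpair_eqE /l q0 (_ : toC (0, 0) = 0)// mul0r add0r negb_and tp0 orbT.
  have cG := continuous_greenR d F d1 hF1 hF2 F0 h l sh sl nz (0, 0).
  have -> : G (0, toC p) = G (h (0, 0), l (0, 0)).
    by rewrite /l /h/= (_ : toC (0, 0) = 0)// mul0r add0r.
  have H : (n.+1%:R^-1 : R, 0 : R) @[n --> \oo] --> ((0, 0) : R * R).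
    exact: (cvg_pair (@cvg_harmonic R) (cvg_cst (0 : R))).
  exact: (cvg_comp (fun n => (n.+1%:R^-1 : R, 0 : R)) (fun q => G (h q, l q)) H cG).
- by apply: origin0 => p p0 n _; rewrite lee_fin b.
Qed.

(** Factor [(t, t z0 + p) = t (1, z0 + p / t)] and use [greenRZ]; the constant [ln t] is averaged
    against a density of mass [1]. *)
Lemma smoothed_smoothed_infty t : 0 < t -> (smoothed t^-1 = smoothed_infty t - (ln t)%:E)%E.
Proof.
move=> t0; have tV0 : 0 <= t^-1 by rewrite invr_ge0 ltW.
have -> : smoothed_infty t = (smoothed t^-1 + (ln t)%:E)%E; last by rewrite addeK.
rewrite /smoothed -[(ln t)%:E]mule1 -integral_kernel -integralZl//; last exact: integrable_kernel.
rewrite -integralD//; last 2 first.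
- exact: integrable_smoothed.
- by apply: integrableZl => //; exact: integrable_kernel.
apply: eq_integral => p _; rewrite -EFinM -EFinD -mulrDl [X in _ = (X * _)%:E]addrC; congr (_ * _)%:E.
have nt : normc (t +i* 0)%C = t by rewrite /= expr0n addr0 sqrtr_sqr gtr0_norm.
have ttV : (t +i* 0)%C * (t^-1 +i* 0)%C = 1.
  apply/eqP; rewrite eq_complex/= !mulr0 mul0r subr0 addr0 mulfV; last by rewrite gt_eqF.
  by rewrite !eqxx.
move: (toC_affine t^-1 p); set w := toC (affine _ _ _) => wE.
have -> : ((t +i* 0)%C, (t +i* 0)%C * z0 + toC p) =
    ((t +i* 0)%C * (1 : C, w).1, (t +i* 0)%C * (1 : C, w).2).
  by rewrite /fst /snd mulr1 wE mulrDr mulrA ttV mul1r.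
by rewrite (greenRZ d F d1 hF1 hF2 F0 _ _ (tC_neq0 _ t0) (oneC_neq0 w)) nt.
Qed.

End regularised_green.

(** * The logarithmic potential of the balanced measure *)

Section sphere_measurability.
Context {R : realType}.

Lemma continuous_ofC : continuous (ofC : R[i]^o -> R * R).
Proof.
have H (g : R[i] -> R) : (forall x y, g (x - y) = g x - g y) ->
    (forall x, `|g x| <= normc x) -> continuous (g : R[i]^o -> R).
  move=> gB gle w A /nbhs_ballP[e e0 eA].
  (* Balls of [R[i]^o] have radii in [R[i]], so a real radius enters as [e +i* 0]. *)
  apply/(@nbhs_ballP R[i] (R[i]^o)); exists (e +i* 0)%C => [|w' h].
    by rewrite /= ltcE/= eqxx.
  apply: eA; move: h; rewrite /ball/= normc_def ltcE/= => /andP[_]; apply: le_lt_trans.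
  by rewrite -gB (le_trans (gle _))//; case: (w - w').
move=> w.
have H1 : continuous (@complex.Re R : R[i]^o -> R).
  apply: H => [[a b] [a' b']//|[a b]/=].
  by rewrite -sqrtr_sqr ler_wsqrtr// lerDl sqr_ge0.
have H2 : continuous (@complex.Im R : R[i]^o -> R).
  apply: H => [[a b] [a' b']//|[a b]/=].
  by rewrite -sqrtr_sqr ler_wsqrtr// lerDr sqr_ge0.
exact: (cvg_pair (H1 w) (H2 w)).
Qed.

Local Notation S := (borelP1 R).

Lemma measurable_finite_plane : measurable (range (@Some R[i]) : set S).
Proof.
apply: sub_sigma_algebra; apply: (@one_point_compactification_open_some (R[i]^o)).
exact: openT.
Qed.

Lemma range_SomeC : ~` range (@Some R[i]) = [set None].
Proof.
apply/seteqP; split => [[w|]//= h|_ -> [w]//].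
by exfalso; apply: h; exists w.
Qed.

Lemma measurable_infty : measurable ([set None] : set S).
Proof. by rewrite -range_SomeC; apply: measurableC; exact: measurable_finite_plane. Qed.

(** Continuity on the plane suffices: the preimage of an open interval is an open subset of the
    plane, possibly together with the point at infinity, which is Borel. *)
Lemma measurable_sphere (g : P1 R -> R) : continuous (fun p => g (Some (toC p))) ->
  measurable_fun setT (g : S -> R).
Proof.
move=> cg; have cg' : continuous ((fun w => g (Some w)) : R[i]^o -> R).
  have -> : (fun w => g (Some w)) = (fun p => g (Some (toC p))) \o ofC.
    by apply/funext => w /=; rewrite ofCK.
  by move=> w; apply: continuous_comp; [exact: continuous_ofC|exact: cg].
apply: (measurability _ (RGenOpens.measurableE R)) => _ [_ [a [b ->] <-]].
rewrite setTI; set O := `]a, b[%classic.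
have -> : g @^-1` O = (Some @` ((fun w => g (Some w)) @^-1` O)) `|`
    ([set None] `&` [set _ | O (g None)]).
  apply/seteqP; split => [[w|] Ox|x [[w Ow <-]//|[-> //]]]; first by left; exists w.
  by right.
apply: measurableU.
  apply: sub_sigma_algebra; apply: (@one_point_compactification_open_some (R[i]^o)).
  by move/continuousP : cg'; apply; exact: interval_open.
have [h|h] := pselect (O (g None)).
  rewrite (_ : [set _ | _] = setT) ?setIT; first exact: measurable_infty.
  by apply/seteqP; split.
rewrite (_ : [set _ | _] = set0) ?setI0; first exact: measurable0.
by apply/seteqP; split.
Qed.

End sphere_measurability.

(** * Monotonicity and limits of the regularised logarithm *)

Section half_log.
Context {R : realType}.
Implicit Types s t r e : R.

Definition half_log s r : R := 1 / 2 * ln (1 + s ^+ 2 * r).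

Let arg_ge1 s r : 0 <= r -> 1 <= 1 + s ^+ 2 * r.
Proof. by move=> r0; rewrite lerDl mulr_ge0 ?sqr_ge0. Qed.

Lemma half_log_ge0 s r : 0 <= r -> 0 <= half_log s r.
Proof. by move=> r0; rewrite mulr_ge0 ?ln_ge0 ?arg_ge1// divr_ge0. Qed.

Lemma half_log_le s t r : 0 <= r -> 0 <= s <= t -> half_log s r <= half_log t r.
Proof.
move=> r0 /andP[s0 st]; rewrite ler_wpM2l ?divr_ge0// ler_ln ?posrE.
- by rewrite lerD2l ler_wpM2r// lerXn2r// nnegrE// (le_trans s0).
- exact: lt_le_trans (arg_ge1 s _ r0).
- exact: lt_le_trans (arg_ge1 t _ r0).
Qed.

(** As [e] tends to [0] with [r > 0], the two summands on the left diverge in opposite directions.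
    The right-hand form shows both the monotonicity in [e] and the limit. *)
Lemma ln_add_half_log e r : 0 < e -> 0 <= r -> ln e + half_log e^-1 r = 1 / 2 * ln (e ^+ 2 + r).
Proof.
move=> e0 r0; have -> : ln e = 1 / 2 * ln (e ^+ 2) by rewrite lnXn// -mulr_natl; lra.
rewrite -mulrDr -lnM ?posrE ?exprn_gt0//; last exact: lt_le_trans (arg_ge1 _ _ r0).
by congr (_ * ln _); field; rewrite gt_eqF.
Qed.

Lemma ln_add_half_log_le e e' r : 0 < e -> e <= e' -> 0 <= r ->
  ln e + half_log e^-1 r <= ln e' + half_log e'^-1 r.
Proof.
move=> e0 ee' r0; have e'0 := lt_le_trans e0 ee'.
rewrite !ln_add_half_log// ler_wpM2l ?divr_ge0// ler_ln ?posrE ?ltr_pwDl ?exprn_gt0//.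
by rewrite lerD2r lerXn2r// nnegrE ltW.
Qed.

Lemma cvg_half_log0 r : 0 <= r -> half_log n.+1%:R^-1 r @[n --> \oo] --> 0.
Proof.
move=> r0; have -> : 0 = 1 / 2 * ln (1 + 0 ^+ 2 * r) :> R.
  by rewrite expr0n/= mul0r addr0 ln1 mulr0.
apply: cvgMl_tmp; apply: continuous_cvg.
  by apply: continuous_ln; rewrite expr0n/= mul0r addr0.
apply: cvgD; first exact: cvg_cst.
by apply: cvgMr_tmp; exact: cvg_sqr cvg_harmonic.
Qed.

Lemma cvg_ln_add_half_log r : 0 < r ->
  ln n.+1%:R^-1 + half_log n.+1%:R^-1^-1 r @[n --> \oo] --> 1 / 2 * ln r.
Proof.
move=> r0.
rewrite (_ : (fun n => _) = fun n => 1 / 2 * ln (n.+1%:R^-1 ^+ 2 + r)); last first.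
  by apply/funext => n; rewrite ln_add_half_log ?invr_gt0// ltW.
apply: cvgMl_tmp; apply: continuous_cvg; first exact: continuous_ln.
rewrite -[X in _ --> X]add0r; apply: cvgD; last exact: cvg_cst.
have -> : 0 = 0 ^+ 2 :> R by rewrite expr0n.
exact: cvg_sqr cvg_harmonic.
Qed.

Lemma cvgy_ln_harmonic : (- ln n.+1%:R^-1 : R)%:E @[n --> \oo] --> +oo%E.
Proof.
under eq_fun do rewrite lnV ?posrE// opprK.
apply/cvgeryP/cvgryPge => A; near=> n.
rewrite -[A]expRK ler_ln ?posrE ?expR_gt0//.
have h : expR A <= n%:R by near: n; exact: nbhs_infty_ger.
by rewrite (le_trans h)// ler_nat.
Unshelve. all: by end_near. Qed.

End half_log.

(** * From the test functions to the potential *)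

Section potential.
Context {R : realType}.
Local Notation C := (R[i]%C).
Local Notation S := (borelP1 R).
Local Notation leb := (@lebesgue_measure R).
Local Notation leb2 := (leb \x leb)%E.
Context (d : nat) (F : C * C -> C * C).
Context (d1 : (1 < d)%N) (hF1 : homogeneous d (fun v => (F v).1))
  (hF2 : homogeneous d (fun v => (F v).2)) (F0 : forall v, F v = (0, 0) <-> v = (0, 0)).
Context (mu : probability S R) (muF : balanced_measure d F mu).
Context (z0 : C).
Local Notation G := (greenR d F).
Local Notation z := (ofC z0).
Local Notation sm := (smoothed d F z0).
Local Notation smoo := (smoothed_infty d F z0).

Let plane : set S := range (@Some C).

(** Identifies the density of [ddc] of [(1 / 2) ln (quad z s p)] with the kernel at scale [1 / s];
    [s ^+ 2] is the Jacobian of the rescaling. *)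
Lemma kernel_quad s p : s ^+ 2 * kernel (s * (p.1 - z.1), s * (p.2 - z.2)) =
  (2 * pi)^-1 * (2 * s ^+ 2 / quad z s p ^+ 2) :> R.
Proof.
rewrite /kernel sqr_norm2/= !exprMn -mulrDr -/(quad z s p).
have q0 := quad_gt0 z s p; have := pi_gt0 R; move: (quad z s p) q0 (@pi R) => q q0 c c0.
by field; rewrite !gt_eqF.
Qed.

Let G_kernel s p : \bar R :=
  (G (1, toC p) * (s ^+ 2 * kernel (s * (p.1 - z.1), s * (p.2 - z.2))))%:E.

Let measurable_G_kernel s : measurable_fun setT (G_kernel s).
Proof.
apply/measurable_EFinP; apply: measurable_funM.
  apply: (measurable_greenR d F d1 hF1 hF2 F0 (fun=> 1) toC); first exact: smooth_cexpr_cst.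
    exact: smooth_cexpr_toC.
  by move=> p; exact: oneC_neq0.
apply: measurable_funM => //.
apply: (measurableT_comp measurable_kernel); apply: measurable_fun_pair;
  by apply: measurable_funM => //; apply: measurable_funB.
Qed.

Let G_kernel_affine s p : 0 < s ->
  G_kernel s (affine z s^-1 p) = (s ^+ 2 * (G (1, toC (affine z s^-1 p)) * kernel p))%:E.
Proof.
move=> s0; rewrite /G_kernel /affine/= mulrCA; congr (_ * (_ * kernel _))%:E.
by rewrite !(addrC _ (s^-1 * _)) !addrK !mulVKf ?gt_eqF// -surjective_pairing.
Qed.

Let integrable_G_kernel s : 0 < s -> leb2.-integrable setT (G_kernel s).
Proof.
move=> s0; have sV0 : 0 < s^-1 by rewrite invr_gt0.
apply: (integrable2_affine z s^-1) => //.
rewrite (_ : G_kernel s \o _ =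
    fun p => ((s ^+ 2)%:E * (G (1, toC (affine z s^-1 p)) * kernel p)%:E)%E).
  by apply: integrableZl => //; apply: (integrable_smoothed d F d1 hF1 hF2 F0); exact: ltW.
by apply/funext => p; rewrite /comp G_kernel_affine// EFinM.
Qed.

Let integral_G_kernel s : 0 < s -> (\int[leb2]_p G_kernel s p = sm s^-1)%E.
Proof.
move=> s0; have sV0 : 0 < s^-1 by rewrite invr_gt0.
have E : G_kernel s \o affine z s^-1 =
    fun p => ((s ^+ 2)%:E * (G (1, toC (affine z s^-1 p)) * kernel p)%:E)%E.
  by apply/funext => p; rewrite /comp G_kernel_affine// EFinM.
have i : leb2.-integrable setT (fun p => (G (1, toC (affine z s^-1 p)) * kernel p)%:E).
  by apply: (integrable_smoothed d F d1 hF1 hF2 F0); exact: ltW.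
rewrite (integral2_affine z s^-1)//; last by rewrite E; apply: integrableZl.
rewrite (_ : (\int[leb2]_p _ = \int[leb2]_p (G_kernel s \o affine z s^-1) p)%E)//.
rewrite E integralZl// muleA -EFinM exprVn mulVf ?mul1e//.
by rewrite expf_neq0// gt_eqF.
Qed.

Lemma smoothed_fin_num e : 0 < e -> sm e \is a fin_num.
Proof.
move=> e0; apply: integrable_fin_num => //.
by apply: (integrable_smoothed d F d1 hF1 hF2 F0); exact: ltW.
Qed.

(** The two parts of the Laplacian contribute [smoothed e - smoothed t^-1]. The [ln t] from
    [smoothed_smoothed_infty] cancels the value of the test function at infinity, leaving a
    right-hand side that converges as [t] tends to [0]. *)
Lemma integral_test e t : 0 < e -> 0 < t ->
  (\int[mu]_x (test z e t x)%:E = sm e - smoo t)%E.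
Proof.
move=> e0 t0; have eV0 : 0 < e^-1 by rewrite invr_gt0.
have tV0 : 0 < t^-1 by rewrite invr_gt0.
have := muF _ (smoothP1_test z e t e0 t0); rewrite /ddc.
rewrite (_ : (\int[leb2]_p _ = \int[leb2]_p (G_kernel e^-1 p - G_kernel t p))%E); last first.
  apply: eq_integral => p _.
  rewrite (greenE d F d1 hF1 hF2 F0); last exact: oneC_neq0.
  rewrite (_ : (fun q => test z e t (Some (toC q))) =
    fun q => ln e + (1 / 2 * ln (quad z e^-1 q) - 1 / 2 * ln (quad z t q))); last first.
    by apply/funext => q; rewrite /test toCK.
  by rewrite laplacian_ln_quad /G_kernel -EFinB -EFinM !kernel_quad -!mulrBr.
rewrite integralB//; last 2 first.
- exact: integrable_G_kernel.
- exact: integrable_G_kernel.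
rewrite !integral_G_kernel// invrK => E.
have f1 := smoothed_fin_num _ e0; have f2 := smoothed_fin_num _ tV0.
have st := smoothed_smoothed_infty d F d1 hF1 hF2 F0 z0 t t0.
rewrite -[LHS](@subeK _ _ (test z e t None)%:E)// -E /= st EFinN.
have : smoo t \is a fin_num.
  by move: f2; rewrite st fin_numB => /andP[].
move: (sm e) f1 (smoo t) => [a| |]// _ [b| |]// _.
by rewrite -!EFinN -!EFinD; congr (_%:E); ring.
Qed.


Let dist2 (w : C) : R := normc (z0 - w) ^+ 2.

Let dist2_ge0 w : 0 <= dist2 w. Proof. exact: sqr_ge0. Qed.

Let quad_dist2 s w : quad z s (ofC w) = 1 + s ^+ 2 * dist2 w.
Proof.
rewrite /quad /dist2; case: z0 w => [a b] [x y]; rewrite /= sqr_sqrtr ?addr_ge0 ?sqr_ge0//.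
by congr (1 + _ * _); ring.
Qed.

Let test_Some e t w :
  test z e t (Some w) = ln e + (half_log e^-1 (dist2 w) - half_log t (dist2 w)).
Proof. by rewrite /test !quad_dist2. Qed.

(** The summand [ln e] is left out to keep the function nonnegative. *)
Let log_reg e (x : S) : R := if x is Some w then half_log e^-1 (dist2 w) else 0.

Let log_reg_ge0 e x : 0 <= log_reg e x.
Proof. by case: x => [w|] //=; exact: half_log_ge0. Qed.

Let measurable_log_reg e : measurable_fun setT (log_reg e).
Proof.
apply: measurable_sphere; apply: smooth_expr_continuous.
rewrite (_ : (fun p => _) = fun p => 1 / 2 * ln (quad z e^-1 p)).
  apply: se_mul; first exact: se_cst.
  by apply: se_ln; [exact: smooth_expr_quad|exact: quad_gt0].
by apply/funext => p; rewrite /= -[in RHS](toCK p) quad_dist2.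
Qed.

Let measurable_test e t : measurable_fun setT (test z e t : S -> R).
Proof.
apply: measurable_sphere; apply: smooth_expr_continuous.
rewrite (_ : (fun p => _) =
    fun p => ln e + (1 / 2 * ln (quad z e^-1 p) + (-1 / 2) * ln (quad z t p))).
  apply: se_add; first exact: se_cst.
  by apply: se_add; (apply: se_mul; first exact: se_cst);
     apply: se_ln; [exact: smooth_expr_quad|exact: quad_gt0|exact: smooth_expr_quad|exact: quad_gt0].
by apply/funext => p; rewrite /test toCK; congr (_ + (_ + _)); rewrite !mulNr.
Qed.

Let planeC : plane `|` [set None] = setT.
Proof. by rewrite -range_SomeC setUv. Qed.

Let harmonic_bounds n : 0 < (n.+1%:R^-1 : R) <= 1.
Proof. by rewrite invr_gt0 ltr0n invf_le1// ler1n. Qed.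

Let harmonic_le m n : (m <= n)%N -> (n.+1%:R^-1 : R) <= m.+1%:R^-1.
Proof. by move=> mn; rewrite lef_pV2 ?posrE// ler_nat. Qed.

(** The test function is bounded: below by [ln e], since [t <= e^-1], and above by [- ln t], by
    monotonicity of the regularised logarithm from scale [e] to scale [t^-1]. *)
Let integrable_test e t : 0 < e <= 1 -> 0 < t <= 1 ->
  mu.-integrable setT (fun x => (test z e t x)%:E).
Proof.
move=> /andP[e0 e1] /andP[t0 t1]; have le := ln_le0 e1; have lt := ln_le0 t1.
have tV : 1 <= t^-1 by rewrite invf_ge1.
have eV : 1 <= e^-1 by rewrite invf_ge1.
apply: (@le_integrable _ _ _ mu setT measurableT _ (cst (- ln e - ln t)%:E)).
- by apply/measurable_EFinP; exact: measurable_test.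
- move=> x _; rewrite /= lee_fin (le_trans _ (ler_norm _))// ler_norml opprB.
  case: x => [w|]; last by rewrite /test; apply/andP; split; lra.
  rewrite test_Some; have h1 := ln_add_half_log_le e t^-1 (dist2 w) e0 (le_trans e1 tV) (dist2_ge0 w).
  have h2 : half_log t (dist2 w) <= half_log e^-1 (dist2 w).
    by rewrite half_log_le// (ltW t0)/= (le_trans t1).
  move: h1; rewrite invrK lnV ?posrE// => h1; apply/andP; split; lra.
- exact: finite_measure_integrable_cst.
Qed.

(** As [t] decreases to [0], [test - ln e] increases, to the half logarithm on the plane and to
    [+oo] at infinity. The bounds [e <= 1] and [t <= 1] make it nonnegative. *)
Let monotone_infty e : 0 < e <= 1 ->
  (\int[mu]_x (if x is Some w then (half_log e^-1 (dist2 w))%:E else +oo) =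
   sm e - (G (0, 1))%:E - (ln e)%:E)%E.
Proof.
move=> /andP[e0 e1].
pose g n (x : S) : \bar R := (test z e n.+1%:R^-1 x - ln e)%:E.
have eV : 1 <= e^-1 by rewrite invf_ge1.
have gE x : (if x is Some w then (half_log e^-1 (dist2 w))%:E else +oo)%E =
    limn (g ^~ x).
  apply/esym/cvg_lim => //; rewrite /g; case: x => [w|].
    under eq_fun do rewrite test_Some addrAC subrr add0r.
    apply: cvg_EFin; first by apply: nearW.
    rewrite /comp/= -[X in _ --> X]subr0.
    by apply: cvgB; [exact: cvg_cst|exact: cvg_half_log0].
  rewrite /test; under eq_fun do rewrite EFinB.
  have -> : +oo%E = (+oo - (ln e)%:E)%E :> \bar R by [].
  by apply: cvgeB => //; [exact: cvgy_ln_harmonic|exact: cvg_cst].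
rewrite (_ : (\int[mu]_x _ = \int[mu]_x limn (g ^~ x))%E); last first.
  by apply: eq_integral => x _; rewrite gE.
rewrite monotone_convergence//.
- apply/cvg_lim => //.
  rewrite (_ : (fun n => _) = fun n => (sm e - smoo n.+1%:R^-1 - (ln e)%:E)%E); last first.
    apply/funext => n; have /andP[n0 n1] := harmonic_bounds n.
    rewrite -(integral_test)//.
    rewrite /g; under eq_integral do rewrite EFinB.
    rewrite integralB//; last 2 first.
    - by apply: integrable_test; rewrite ?e0 ?n0.
    - exact: finite_measure_integrable_cst.
    rewrite integral_cst//; congr (_ - _)%E; rewrite -[RHS]mule1; congr (_ * _)%E.
    exact: probability_setT.
  apply: cvgeB; [by rewrite fin_num_adde_defl| |exact: cvg_cst].
  apply: cvgeB; [by rewrite fin_num_adde_defl|exact: cvg_cst|].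
  exact: (cvg_smoothed_infty d F d1 hF1 hF2 F0 z0).
- by move=> n; apply/measurable_EFinP; apply: measurable_funB => //; exact: measurable_test.
- move=> n x _; rewrite lee_fin; have /andP[n0 n1] := harmonic_bounds n.
  case: x => [w|].
    rewrite test_Some addrAC subrr add0r subr_ge0 half_log_le// (ltW n0)/=.
    exact: le_trans n1 eV.
  by rewrite /test; have := ln_le0 n1; have := ln_le0 e1; lra.
- move=> x _ m n mn; rewrite lee_fin lerD2r.
  have /andP[n0 n1] := harmonic_bounds n; have /andP[m0 m1] := harmonic_bounds m.
  case: x => [w|].
    by rewrite !test_Some lerD2l lerD2l lerN2 half_log_le// (ltW n0)/= harmonic_le.
  by rewrite /test lerN2 ler_ln ?posrE// harmonic_le.
Qed.


Let measurable_plane : measurable plane. Proof. exact: measurable_finite_plane. Qed.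

Let disjoint_plane : [disjoint plane & [set None]].
Proof. by rewrite -range_SomeC; exact/disj_setPCl. Qed.

(** The limit in [monotone_infty] is finite although the integrand is [+oo] at infinity, so that
    point has mass zero and the plane carries the whole integral. *)
Let ext_log_reg_integral e : 0 < e <= 1 -> mu [set None] = 0%E /\
  (\int[mu]_(x in plane) (log_reg e x)%:E = sm e - (G (0, 1))%:E - (ln e)%:E)%E.
Proof.
move=> e01; have /andP[e0 e1] := e01.
have := monotone_infty _ e01; set f := (fun x => _).
have fplane : {in plane, f =1 fun x => (log_reg e x)%:E}.
  by move=> x; rewrite inE => -[w _ <-].
have fNone : {in ([set None] : set S), f =1 (cst +oo%E : S -> \bar R)} by move=> x; rewrite inE => ->.
have mf : measurable_fun setT f.
  rewrite -planeC; apply/measurable_funU => //; first exact: measurable_infty.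
  split; last exact: measurable_fun_set1.
  apply: (eq_measurable_fun (fun x => (log_reg e x)%:E)).
    by move=> x xp; rewrite fplane.
  by apply/measurable_EFinP/measurable_funTS; exact: measurable_log_reg.
have f0 x : (0 <= f x)%E by case: x => [w|]; rewrite /f ?lee_fin ?half_log_ge0// leey.
rewrite -[in LHS]planeC ge0_integral_setU//; last 2 first.
- by rewrite planeC.
- by move=> x _; exact: f0.
rewrite (eq_integral (fun x => (log_reg e x)%:E) _ fplane).
rewrite (eq_integral (cst +oo%E : S -> \bar R) _ fNone) integral_cst//; last exact: measurable_infty.
have fsm := smoothed_fin_num e e0.
have P0 : (0 <= \int[mu]_(x in plane) (log_reg e x)%:E)%E.
  by apply: integral_ge0 => x _; rewrite lee_fin.
rewrite [X in (+oo * X)%E](_ : _ = mu [set None])//.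
have [->|n0] := eqVneq (mu [set None]) 0%E; first by rewrite mule0 adde0.
rewrite gt0_mulye; last by rewrite lt0e n0 measure_ge0.
rewrite addey; last by rewrite -ltNye (lt_le_trans _ P0).
  by case: (sm e) fsm => // a _; rewrite -!EFinB.
exact: measurable_infty.
Qed.

Let mu_infty : mu [set None] = 0%E.
Proof. by have [] := ext_log_reg_integral 1 ltac:(by rewrite ltr01 lexx). Qed.

Let mu_plane : mu plane = 1%E.
Proof.
rewrite -(@probability_setT _ _ _ mu) -planeC measureU//; last 2 first.
- exact: measurable_infty.
- by rewrite -range_SomeC setICr.
by rewrite [X in (_ + X)%E]mu_infty adde0.
Qed.

Let integral_log_reg e : 0 < e <= 1 ->
  (\int[mu]_(x in plane) (log_reg e x)%:E = sm e - (G (0, 1))%:E - (ln e)%:E)%E.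
Proof. by move=> /ext_log_reg_integral[]. Qed.

Let integrable_log_reg e : 0 < e <= 1 -> mu.-integrable plane (fun x => (log_reg e x)%:E).
Proof.
move=> e01; have /andP[e0 e1] := e01; apply/integrableP; split.
  by apply/measurable_EFinP/measurable_funTS; exact: measurable_log_reg.
rewrite (_ : (\int[mu]_(x in plane) _ = \int[mu]_(x in plane) (log_reg e x)%:E)%E).
  rewrite integral_log_reg//.
  by case: (sm e) (smoothed_fin_num e e0) => // a _; rewrite -!EFinB ltry.
by apply: eq_integral => x _; rewrite gee0_abs// lee_fin.
Qed.

Let lognorm (x : S) : \bar R := if x is Some w then lne (normc (z0 - w))%:E else 0%E.

(** The regularised logarithms decrease to the logarithm. Subtracting them from the one at scale
    [1], where [ln 1 = 0], turns them into a nonnegative increasing sequence. *)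
Let h n (x : S) : \bar R := (log_reg 1 x - (ln n.+1%:R^-1 + log_reg n.+1%:R^-1 x))%:E.

Let cvg_h x : plane x -> h n x @[n --> \oo] --> ((log_reg 1 x)%:E - lognorm x)%E.
Proof.
move=> [w _ <-]; rewrite /h /lognorm.
have [w0|w0] := eqVneq (normc (z0 - w)) 0.
  (* At the pole the half logarithms vanish and [h n] reduces to [ln (n + 1)], in agreement with
     [lne 0 = -oo]. *)
  have d0 : dist2 w = 0 by rewrite /dist2 w0 expr0n.
  have hl0 (s : R) : half_log s 0 = 0 by rewrite /half_log mulr0 addr0 ln1 mulr0.
  have -> : ((log_reg 1 (Some w))%:E - lne (normc (z0 - w))%:E = +oo)%E by rewrite w0 /= lexx.
  rewrite /log_reg d0; under eq_fun do rewrite !hl0 addr0 sub0r.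
  exact: cvgy_ln_harmonic.
have w1 : 0 < normc (z0 - w) by rewrite lt_neqAle eq_sym w0 normc_ge0.
have d0 : 0 < dist2 w by rewrite exprn_gt0.
rewrite lne_EFin// -EFinB; apply: cvg_EFin; first by apply: nearW.
rewrite /comp/=; apply: cvgB; first exact: cvg_cst.
rewrite [X in _ --> X](_ : _ = 1 / 2 * ln (dist2 w)); first exact: cvg_ln_add_half_log.
by rewrite /dist2 lnXn// -[ln _ *+ _]mulr_natl mulrA divfK// mul1r.
Qed.

(** Monotone convergence gives the integral of [log_reg 1 - lognorm] as [smoothed 1 - G (1, z0)],
    which is finite. Subtracting it from the integral of [log_reg 1], namely
    [smoothed 1 - G (0, 1)], eliminates [smoothed 1]. *)
Lemma log_potential_green : log_potential mu z0 = (G (1, z0) - G (0, 1))%:E.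
Proof.
have e1 : 0 < (1 : R) <= 1 by rewrite ltr01 lexx.
have mh n : measurable_fun plane (h n).
  apply/measurable_EFinP; apply: measurable_funTS; apply: measurable_funB.
    exact: measurable_log_reg.
  by apply: measurable_funD => //; exact: measurable_log_reg.
have h0 n x : plane x -> (0 <= h n x)%E.
  move=> [w _ <-]; have /andP[n0 n1] := harmonic_bounds n.
  have := ln_add_half_log_le _ _ (dist2 w) n0 n1 (dist2_ge0 w).
  by rewrite ln1 add0r lee_fin subr_ge0.
have ndh x : plane x -> nondecreasing_seq (h ^~ x).
  move=> [w _ <-] m n mn; rewrite lee_fin lerD2l lerN2.
  have /andP[n0 n1] := harmonic_bounds n.
  exact: ln_add_half_log_le (harmonic_le _ _ mn) (dist2_ge0 w).
(* Both [G (0, 1)] and the two occurrences of [ln n.+1%:R^-1] cancel, the plane having mass [1]. *)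
have ih n : (\int[mu]_(x in plane) h n x = sm 1 - sm n.+1%:R^-1)%E.
  have hn := harmonic_bounds n; have /andP[n0 n1] := hn.
  under eq_integral do rewrite /h EFinB EFinD.
  rewrite integralB//; last 2 first.
  - exact: integrable_log_reg.
  - apply: integrableD => //; last exact: integrable_log_reg.
    exact: finite_measure_integrable_cst.
  rewrite integralD//; last 2 first.
  - exact: finite_measure_integrable_cst.
  - exact: integrable_log_reg.
  rewrite integral_cst// [X in (_ * X + _)%E]mu_plane mule1 !integral_log_reg// ln1.
  have := smoothed_fin_num 1 ltr01.
  have := smoothed_fin_num _ n0.
  case: (sm 1) => // a; case: (sm _) => // b _ _.
  by rewrite -!(EFinB, EFinD); congr (_%:E); ring.
have fin1 := smoothed_fin_num 1 ltr01.
pose L x := ((log_reg 1 x)%:E - lognorm x)%E.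
have intL : (\int[mu]_(x in plane) L x = sm 1 - (G (1, z0))%:E)%E.
  rewrite (_ : (\int[mu]_(x in plane) L x = \int[mu]_(x in plane) limn (h ^~ x))%E).
    rewrite monotone_convergence//; apply/cvg_lim => //.
    rewrite (_ : (fun n => _) = fun n => (sm 1 - sm n.+1%:R^-1)%E); last exact/funext.
    apply: cvgeB; [by rewrite fin_num_adde_defl|exact: cvg_cst|].
    exact: (cvg_smoothed d F d1 hF1 hF2 F0 z0).
  by apply: eq_integral => x; rewrite inE => xp; apply/esym/cvg_lim => //; exact: cvg_h.
have L0 x : plane x -> (0 <= L x)%E.
  move=> xp; have := cvg_h x xp => c; rewrite /L -(cvg_lim _ c)//.
  by apply: lime_ge; [apply/cvg_ex; eexists; exact: c|apply: nearW => n; exact: h0].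
have iL : mu.-integrable plane L.
  apply/integrableP; split.
    by apply: (emeasurable_fun_cvg _ _ mh) => x xp; exact: cvg_h.
  rewrite (_ : (\int[mu]_(x in plane) _ = \int[mu]_(x in plane) L x)%E).
    by rewrite intL; case: (sm 1) fin1 => // a _; rewrite -EFinB ltry.
  by apply: eq_integral => x; rewrite inE => xp; rewrite gee0_abs// L0.
rewrite /log_potential -/plane.
rewrite (_ : (\int[mu]_(x in plane) _ =
    \int[mu]_(x in plane) ((log_reg 1 x)%:E - L x))%E); last first.
  (* The identity persists at [w = z0], where [L] is [+oo] and both sides are [-oo]. *)
  apply: eq_integral => x; rewrite inE => -[w _ <-]; rewrite /L /lognorm.
  by case: (lne _) => [r| |] //; rewrite -!EFinB opprB addrC subrK.
rewrite integralB//; last exact: integrable_log_reg.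
rewrite intL integral_log_reg// ln1.
by case: (sm 1) fin1 => // a _; rewrite -!EFinB; congr (_%:E); ring.
Qed.

End potential.

Theorem lemma3p3 (R : realType) (d : nat) (f : P1 R -> P1 R)
    (F : R[i] * R[i] -> R[i] * R[i]) (D : set (P1 R))
    (mu : probability (borelP1 R) R) :
  (1 < d)%N ->
  rational_map d f ->
  is_lift d f F ->
  fatou_component f D -> D None -> f @` D = D ->
  balanced_measure d F mu ->
  forall z w : R[i], f (Some z) = Some w ->
    (log_potential mu w
     = d%:R%:E * log_potential mu z - lne (normc (F (1%R, z)).1)%:E
       + (d%:R - 1)%:E * green d F (0%R, 1%R))%E.
Proof.
move=> d1 _ [hF1 hF2 hF F0] _ _ _ muF z w fzw.
have z1 : (1 : R[i]%C, z) != (0, 0) by exact: oneC_neq0.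
have := hF (1, z) z1; rewrite {2}/Defs.proj oner_eq0 divr1 fzw /Defs.proj.
case: ifPn => [//|c0] [wE].
(* Finiteness of [f z] makes [c], the first coordinate of [F (1, z)], nonzero, so
   [F (1, z) = c (1, w)] and [d G(1, z) = log |c| + G(1, w)]. Replacing each [G(1, .)] by the
   potential plus [G(0, 1)] leaves [d - 1] copies of that constant. *)
have FE : F (1, z) = ((F (1, z)).1 * (1 : R[i]%C, w).1, (F (1, z)).1 * (1 : R[i]%C, w).2).
  by rewrite /= mulr1 -wE mulrC divfK// -surjective_pairing.
have GE := greenR_lift d F d1 hF1 hF2 F0 (1, z) z1.
rewrite FE (greenRZ d F d1 hF1 hF2 F0 _ _ c0 (oneC_neq0 w)) in GE.
rewrite !(log_potential_green d F d1 hF1 hF2 F0 mu muF).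
rewrite (greenE d F d1 hF1 hF2 F0); last by rewrite xpair_eqE oner_eq0 andbF.
rewrite lne_EFin ?normc_gt0// -!(EFinM, EFinB, EFinD); congr (_%:E).
lra.
Qed.
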